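(* Let $d\ge 1$, let $\mathbf{Y}$ be a bounded random vector in $\mathbb{R}^d$, and let $\mathbf{Z}$ be a standard centered normal random vector in $\mathbb{R}^d$ (i.e. with law $(2\pi)^{-d/2}e^{-|\mathbf{x}|^2/2}\,d\mathbf{x}$) independent from $\mathbf{Y}$. Let $\||\mathbf{Y}|\|_\infty$ denote the $L^\infty$-norm (essential supremum) of the Euclidean norm $|\mathbf{Y}|$. Then for every $t$ with $0<t\le\||\mathbf{Y}|\|_\infty^2$, the law of $\mathbf{Y}+\sqrt{t}\,\mathbf{Z}$ satisfies a log-Sobolev inequality with a constant $c(t)$ satisfying $$c(t)\le 289\,\||\mathbf{Y}|\|_\infty^2\exp\left(20d+\frac{5\||\mathbf{Y}|\|_\infty^2}{t}\right).$$
   Context: A probability measure $\mu$ on $\mathbb{R}^d$ satisfies a log-Sobolev inequality with constant $c$ if $\mathrm{Ent}_\mu(f^2)\le c\int|\nabla f|^2\,d\mu$ for all sufficiently integrable positive functions $f$ with $\int f^2\,d\mu=1$ (e.g. all positive continuously differentiable $f$ with $\int f^2\,d\mu=1$ and $\int|\nabla f|^2\,d\mu<\infty$), where $\mathrm{Ent}_\mu(g)=\int g\log g\,d\mu$ for a probability density $g$ with respect to $\mu$. *)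

(* Defs.v *)
From HB Require Import structures.
From mathcomp Require Import all_boot all_order all_algebra.
From mathcomp Require Import all_classical all_reals all_analysis.
From mathcomp Require Import measurable_realfun.
Set Implicit Arguments.
Unset Strict Implicit.
Unset Printing Implicit Defensive.
Import Order.TTheory GRing.Theory Num.Theory.
Import numFieldNormedType.Exports.
Local Open Scope classical_set_scope.
Local Open Scope ring_scope.

(* R^n is 'rV[R]_n, with its Borel sigma-algebra (the topology of the library
   sup norm on matrices is the Euclidean one). *)
HB.instance Definition _ (R : realType) (n : nat) :=
  Measurable.copy 'rV[R]_n (g_sigma_algebraType (@open 'rV[R]_n)).

Section measurability_rV.
Context {R : realType} {n : nat}.

Lemma continuous_rV_measurable_fun (f : 'rV[R]_n -> R) :
  continuous f -> measurable_fun setT f.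
Proof.
move=> /continuousP cf; apply: (measurability _ (RGenOpens.measurableE R)).
move=> _ [_ [a [b ->] <-]]; rewrite setTI; apply: sub_sigma_algebra.
exact/cf/interval_open.
Qed.

Lemma measurable_coord (i : 'I_n) :
  measurable_fun setT (fun v : 'rV[R]_n => v 0 i).
Proof. by apply: continuous_rV_measurable_fun; exact: coord_continuous. Qed.

Lemma measurable_rV d (T : measurableType d) (f : T -> 'rV[R]_n) :
  (forall i, measurable_fun setT (fun x => f x 0 i)) -> measurable_fun setT f.
Proof.
move=> mf; apply: (@measurability _ _ _ _ _ _ (@open 'rV[R]_n)) => //.
move=> _ [U oU <-]; rewrite setTI.
pose box (q : {ffun 'I_n -> rat * rat}) :=
  [set v : 'rV[R]_n | forall i, v 0 i \in `](ratr (q i).1 : R), ratr (q i).2[].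
pose F k := if unpickle k is Some q then
  (if `[< box q `<=` U >] then box q else set0) else set0.
suff -> : U = \bigcup_k F k.
  rewrite preimage_bigcup; apply: bigcupT_measurable => k.
  rewrite /F; case: unpickle => [q|]; last by rewrite preimage_set0.
  case: asboolP => _; last by rewrite preimage_set0.
  rewrite (_ : _ @^-1` _ = \bigcap_(i in [set: 'I_n])
      ((fun x => f x 0 i) @^-1` [set` `](ratr (q i).1 : R), ratr (q i).2[])).
    apply: fin_bigcap_measurable; first exact: finite_finset.
    by move=> i _; rewrite -[X in measurable X]setTI; exact: mf.
  by apply/seteqP; split => x /= xq i; [move=> _|]; exact: xq.
apply/seteqP; split => [v Uv|v [k _]]; last first.
  by rewrite /F; case: unpickle => [q|[]]; case: asboolP => [qU /qU|_ []].
have [P nP PU] : nbhs v U by exact: open_nbhs_nbhs.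
have /choice[q Hq] : forall i, exists q : rat * rat,
    (v 0 i \in `](ratr q.1 : R), ratr q.2[) /\
    [set` `](ratr q.1 : R), ratr q.2[] `<=` P 0 i.
  move=> i; have /nbhs_ballP[e /= e0 eP] := nP 0 i.
  have /rat_in_itvoo[a av] : v 0 i - e < v 0 i by rewrite ltrBlDr ltrDl.
  have /rat_in_itvoo[b bv] : v 0 i < v 0 i + e by rewrite ltrDl.
  exists (a, b); split => /=; first by rewrite in_itv/= (itvP av) (itvP bv).
  move=> x /= xab; apply: eP; rewrite /ball /= distrC ltr_distl.
  rewrite (lt_trans _ (_ : ratr a < x)) ?(itvP av) ?(itvP xab)//=.
  by rewrite (lt_trans (_ : x < ratr b)) ?(itvP bv) ?(itvP xab).
have qU : box (finfun q) `<=` U.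
  move=> w wq; apply: PU => i j; rewrite ord1.
  by have [_] := Hq j; apply; have := wq j; rewrite ffunE.
exists (pickle (finfun q)) => //; rewrite /F pickleK; case: asboolP => // _ i.
by rewrite ffunE; exact: (Hq i).1.
Qed.

End measurability_rV.

Section Lebesgue_measure_rV.
Context {R : realType}.

Definition rV_cons n (p : R * 'rV[R]_n) : 'rV[R]_n.+1 := row_mx p.1%:M p.2.

Lemma rV_cons0 n (p : R * 'rV[R]_n) : rV_cons p 0 ord0 = p.1.
Proof.
have e : ord0 = lshift n ord0 :> 'I_(1 + n) by exact/val_inj.
rewrite (congr1 (rV_cons p 0) e : _ = _).
by rewrite [LHS]row_mxEl mxE.
Qed.

Lemma rV_consS n (p : R * 'rV[R]_n) (i : 'I_n) :
  rV_cons p 0 (lift ord0 i) = p.2 0 i.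
Proof.
have e : lift ord0 i = rshift 1 i :> 'I_(1 + n) by exact/val_inj.
by rewrite (congr1 (rV_cons p 0) e : _ = _) [LHS]row_mxEr.
Qed.

Lemma measurable_rV_cons n : measurable_fun setT (@rV_cons n).
Proof.
apply: measurable_rV => i; have [->|[j ->]] : i = ord0 \/ exists j, i = lift ord0 j.
- by case: (unliftP ord0 i) => [j ->|->]; [right; exists j|left].
- by under eq_fun do rewrite rV_cons0; exact: measurable_fst.
- under eq_fun do rewrite rV_consS.
  exact: measurableT_comp (measurable_coord j) measurable_snd.
Qed.

HB.instance Definition _ n :=
  isMeasurableFun.Build _ _ _ _ (@rV_cons n) (@measurable_rV_cons n).

Definition rV_rect n (A : 'I_n -> set R) : set 'rV[R]_n :=
  [set v | forall i, A i (v 0 i)].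

Lemma measurable_rV_rect n (A : 'I_n -> set R) :
  (forall i, measurable (A i)) -> measurable (rV_rect A).
Proof.
move=> mA; rewrite (_ : rV_rect A = \bigcap_(i in [set: 'I_n])
    ((fun v : 'rV[R]_n => v 0 i) @^-1` A i)).
  apply: fin_bigcap_measurable; first exact: finite_finset.
  by move=> i _; rewrite -[X in measurable X]setTI; exact: measurable_coord.
by apply/seteqP; split => v Av i; [move=> _|]; exact: Av.
Qed.

Lemma preimage_rV_cons_rect n (A : 'I_n.+1 -> set R) :
  @rV_cons n @^-1` rV_rect A = A ord0 `*` rV_rect (fun i => A (lift ord0 i)).
Proof.
apply/seteqP; split => [[x v] /= Av|[x v] /= [Ax Av] i].
  split => /=; first by have := Av ord0; rewrite rV_cons0.
  by move=> i; have := Av (lift ord0 i); rewrite rV_consS.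
by case: (unliftP ord0 i) => [j ->|->]; rewrite ?rV_consS ?rV_cons0.
Qed.

Section step.
Context (n : nat) (mu : {sigma_finite_measure set 'rV[R]_n -> \bar R}).

Definition lebesgue_rV_step : set 'rV[R]_n.+1 -> \bar R :=
  pushforward (lebesgue_measure \x mu)%E (@rV_cons n).

Let lebesgue_rV_step0 : lebesgue_rV_step set0 = 0%E.
Proof. by apply: measure0; exact: measurable_rV_cons. Qed.

Let lebesgue_rV_step_ge0 A : (0 <= lebesgue_rV_step A)%E.
Proof. by apply: measure_ge0; exact: measurable_rV_cons. Qed.

Let lebesgue_rV_step_sigma_additive : semi_sigma_additive lebesgue_rV_step.
Proof.
by apply: measure_semi_sigma_additive; exact: measurable_rV_cons.
Qed.

HB.instance Definition _ := isMeasure.Build _ _ _ lebesgue_rV_step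
  lebesgue_rV_step0 lebesgue_rV_step_ge0 lebesgue_rV_step_sigma_additive.

Let lebesgue_rV_step_sigma_finite : sigma_finite setT lebesgue_rV_step.
Proof.
have /sigma_finiteP[F [TF ndF Foo]] := sigma_finiteT (@lebesgue_measure R).
have /sigma_finiteP[G [TG ndG Goo]] := sigma_finiteT mu.
pose uncons (v : 'rV[R]_n.+1) : R * 'rV[R]_n := (v 0 ord0, \row_i v 0 (lift ord0 i)).
have consK : cancel (@rV_cons n) uncons.
  move=> [x v]; congr (_, _); first exact: rV_cons0.
  by apply/rowP => i; rewrite mxE rV_consS.
have muncons : measurable_fun setT uncons.
  apply: measurable_fun_pair; first exact: measurable_coord.
  apply: measurable_rV => i; under eq_fun do rewrite mxE.
  exact: measurable_coord.
exists (fun k => uncons @^-1` (F k `*` G k)).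
  apply/seteqP; split => // v _.
  have [i _ Fi] : (\bigcup_i F i) (uncons v).1 by rewrite -TF.
  have [j _ Gj] : (\bigcup_i G i) (uncons v).2 by rewrite -TG.
  exists (maxn i j) => //; split.
    by move: Fi; exact/subsetPset/ndF/leq_maxl.
  by move: Gj; exact/subsetPset/ndG/leq_maxr.
move=> k; have [mF Fk] := Foo k; have [mG Gk] := Goo k; split.
  by rewrite -[X in measurable X]setTI; apply: muncons => //; exact: measurableX.
rewrite /lebesgue_rV_step /pushforward -comp_preimage.
rewrite (_ : uncons \o _ = id) ?preimage_id; last exact/funext.
by rewrite product_measure1E// lte_mul_pinfty// ge0_fin_numE.
Qed.

HB.instance Definition _ :=
  Measure_isSigmaFinite.Build _ _ _ lebesgue_rV_step lebesgue_rV_step_sigma_finite.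
End step.

Fixpoint lebesgue_rV n : {sigma_finite_measure set 'rV[R]_n -> \bar R} :=
  match n with
  | 0 => dirac (0 : 'rV[R]_0)
  | n.+1 => lebesgue_rV_step (lebesgue_rV n)
  end.

Lemma lebesgue_rV_rect n (A : 'I_n -> set R) :
  (forall i, measurable (A i)) ->
  lebesgue_rV n (rV_rect A) = (\prod_(i < n) lebesgue_measure (A i))%E.
Proof.
elim: n A => [|n IHn] A mA.
  rewrite big_ord0 /= diracE mem_set//; by move=> [].
rewrite big_ord_recl /= /lebesgue_rV_step /pushforward preimage_rV_cons_rect.
by rewrite product_measure1E ?IHn//; [exact: mA|exact: measurable_rV_rect].
Qed.

End Lebesgue_measure_rV.

Section random_vectors.
Context {R : realType}.

Definition eucl_norm n (v : 'rV[R]_n) : R :=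
  Num.sqrt (\sum_(i < n) v 0 i ^+ 2).

Section add_scale.
Context d (T : measurableType d) (n : nat).

Definition add_scale (X Y : T -> 'rV[R]_n) (a : R) : T -> 'rV[R]_n :=
  fun w => X w + a *: Y w.

Context (X Y : {mfun T >-> 'rV[R]_n}) (a : R).

Let measurable_add_scale : measurable_fun setT (add_scale X Y a).
Proof.
have mcoord (V : {mfun T >-> 'rV[R]_n}) i : measurable_fun setT (fun w => V w 0 i).
  exact: measurableT_comp (measurable_coord i) (measurable_funPT V).
apply: measurable_rV => i; under eq_fun do rewrite !mxE.
by apply: measurable_funD => //; exact: measurable_funM.
Qed.

HB.instance Definition _ :=
  isMeasurableFun.Build _ _ T 'rV[R]_n (add_scale X Y a) measurable_add_scale.

End add_scale.

Context d (T : measurableType d) (P : probability T R).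

Definition Linfty_norm n (X : {RV P >-> 'rV[R]_n}) : \bar R :=
  'N[P]_(+oo)[(fun w => (eucl_norm (X w))%:E)]%E.

Definition independent_RV d1 d2 (T1 : measurableType d1)
    (T2 : measurableType d2) (X : {RV P >-> T1}) (Y : {RV P >-> T2}) :=
  forall A B, measurable A -> measurable B ->
    P (X @^-1` A `&` Y @^-1` B) = (P (X @^-1` A) * P (Y @^-1` B))%E.

Definition std_normal_pdf n (x : 'rV[R]_n) : R :=
  (2 * pi) `^ (- (n%:R / 2)) * expR (- (eucl_norm x ^+ 2 / 2)).

Definition std_normal_RV n (Z : {RV P >-> 'rV[R]_n}) :=
  forall A, measurable A -> distribution P Z A =
    (\int[lebesgue_rV n]_(x in A) (std_normal_pdf x)%:E)%E.

End random_vectors.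

Section log_Sobolev.
Context {R : realType} {n : nat}.

Definition gradient (f : 'rV[R]_n -> R) (x : 'rV[R]_n) : 'rV[R]_n :=
  \row_i 'D_(delta_mx 0 i) f x.

Definition continuously_differentiable (f : 'rV[R]_n -> R) :=
  (forall x, differentiable f x) /\ continuous (gradient f).

Local Open Scope ereal_scope.
Context (mu : probability 'rV[R]_n R).

(* The negative part of g * ln g is bounded, so this integral is always
   meaningful in ]-oo, +oo] when g is positive. *)
Definition entropy (g : 'rV[R]_n -> R) : \bar R :=
  \int[mu]_x (g x * ln (g x))%:E.

Definition log_sobolev (c : R) :=
  forall f : 'rV[R]_n -> R,
    (forall x, 0 < f x)%R -> continuously_differentiable f ->
    \int[mu]_x (f x ^+ 2)%:E = 1 ->
    \int[mu]_x (eucl_norm (gradient f x) ^+ 2)%:E < +oo ->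
  entropy (fun x => f x ^+ 2)%R <=
    c%:E * \int[mu]_x (eucl_norm (gradient f x) ^+ 2)%:E.

End log_Sobolev.

(* Main.v *)
(* Let s = sqrt t, let P_y be the law of y + s Z, and write kl(u, m) for
   u ln (u / m) - u + m. The Gaussian log-Sobolev inequality (by monotone
   transport in dimension 1, then tensorization) bounds the P_y-integral of
   kl(f^2, g(y)), where g(y) is the mean of f^2 under P_y. The constant g(y) is
   then replaced by the mean q of f^2 under the fixed measure Q = N(0, t/2),
   which does not depend on y: the density of Q with respect to P_y is bounded
   when |y| <= M, so kl(q, g(y)) is controlled by Jensen's inequality, and
   kl(g(y), q) is controlled in turn by kl(q, g(y)) when g(y) <= 4 q and by the
   entropy inequality when g(y) > 4 q. Averaging over the law of Y gives the
   bound on the integral of kl(f^2, q), which dominates the entropy of f^2. *)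
Require Import Defs.
From HB Require Import structures.
From mathcomp Require Import all_boot all_order all_algebra.
From mathcomp Require Import all_classical all_reals all_analysis.
From mathcomp Require Import measurable_realfun ess_sup_inf ring lra.
Set Implicit Arguments.
Unset Strict Implicit.
Unset Printing Implicit Defensive.
Import Order.TTheory GRing.Theory Num.Theory.
Import numFieldNormedType.Exports.
Local Open Scope classical_set_scope.
Local Open Scope ring_scope.

(** The law of [Y] is arbitrary, possibly discrete, so no functional inequality in [y] can control
    the fluctuation of [g]; each [g(y)] has to be compared with one common constant, through a
    density. The variance [t/2] makes this comparison possible: relative to [P_y], the law N(0, t)
    has a log-affine density, unbounded unless [y = 0], whereas the density [p] of N(0, t/2) has
    Gaussian decay and is at most [sqrt 2 ^ d * exp (|y|^2 / t)]. Since [1 / p] is unbounded, only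
    [kl(q, g(y))] comes directly from Jensen. Exchanging the arguments costs a constant as long as
    [g(y) / q] stays bounded, but a logarithm of that ratio when it is large. This logarithm is
    absorbed by testing the entropy inequality with [p^(-1/2)]; the power is dictated by
    integrability, as [1 / p] has infinite integral under [P_y] and [p^(-1/2)] has not. The affine
    correction in [kl] makes every integrand nonnegative, so the integrals live in [0, +oo] and
    Tonelli applies before finiteness is known. *)

Section relative_entropy_density.
Context {R : realType}.
Implicit Types a b u w m x : R.

(* The integrand of the relative entropy with its affine correction, so that it
   is nonnegative; since [ln 0 = 0] its value at [u = 0] is the limit [m]. *)
Definition kl u m := u * (ln u - ln m) - u + m.

Lemma ln_le_subr1 x : 0 < x -> ln x <= x - 1.
Proof.
move=> x0; rewrite -(ler_expR) lnK ?posrE//.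
by rewrite (le_trans _ (expR_ge1Dx _))// addrC subrK.
Qed.

(** [kl] is jointly convex and homogeneous of degree 1, so its tangent plane at [(U, W)] has no
    constant term and is the left-hand side. The bound is [ln z <= z - 1] at
    [z = (U / W) / (u / w)]; at [u = 0] the convention for [ln 0] makes [kl 0 w = w]. *)
Lemma kl_tangent u w U W : 0 <= u -> 0 < w -> 0 < U -> 0 < W ->
  u * ln (U / W) + w * (1 - U / W) <= kl u w.
Proof.
move=> u0 w0 U0 W0; rewrite /kl.
have [->|un0] := eqVneq u 0.
  have q0 : 0 <= U / W by rewrite divr_ge0// ltW.
  by rewrite !mul0r oppr0 !add0r; nra.
have {un0}u0 : 0 < u by rewrite lt_def un0.
rewrite -ln_div ?posrE//.
have x0 : 0 < (U / W) / (u / w) by rewrite !divr_gt0.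
have := ln_le_subr1 x0; rewrite (ln_div (x := U / W)) ?posrE ?divr_gt0//.
move=> /(ler_wpM2l (ltW u0)).
have -> : u * (U / W / (u / w) - 1) = w * (U / W) - u.
  by field; rewrite !gt_eqF.
by nra.
Qed.

Lemma kl_ge0 u m : 0 <= u -> 0 < m -> 0 <= kl u m.
Proof.
move=> u0 m0; have := kl_tangent u0 m0 m0 m0.
by rewrite divff ?gt_eqF// ln1 subrr !mulr0 addr0.
Qed.

Lemma kl_diag m : kl m m = 0.
Proof. by rewrite /kl subrr mulr0 add0r addNr. Qed.

Lemma kl_homogeneous u m c : 0 < c -> 0 < u -> 0 < m ->
  kl (u * c) (m * c) = c * kl u m.
Proof.
move=> c0 u0 m0; rewrite /kl !lnM ?posrE//.
by ring.
Qed.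

(** Entropy inequality in pointwise form: the tangent to [kl] at [(m * r, m)], where [m * (r - 1)]
    is the convex conjugate of [kl _ m] at [ln r]. *)
Lemma kl_young u m r : 0 < u -> 0 < m -> 0 < r ->
  u * ln r <= kl u m + m * (r - 1).
Proof.
move=> u0 m0 r0; have := kl_tangent (ltW u0) m0 (mulr_gt0 m0 r0) m0.
rewrite [m * r / m]mulrAC divff ?gt_eqF// mul1r.
by nra.
Qed.


(** The Hellinger quantity on the left is symmetric in [a] and [b], which makes it the intermediary
    for exchanging the arguments of [kl]. It comes from [ln (A / B) <= A / B - 1] with [A], [B] the
    square roots, multiplied by [2 * B ^ 2]. *)
Lemma sqr_sqrtB_le_kl a b : 0 < a -> 0 < b ->
  (Num.sqrt a - Num.sqrt b) ^+ 2 <= kl b a.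
Proof.
move=> a0 b0; have A0 : 0 < Num.sqrt a by rewrite sqrtr_gt0.
have B0 : 0 < Num.sqrt b by rewrite sqrtr_gt0.
have := ln_le_subr1 (divr_gt0 A0 B0); rewrite /kl.
rewrite -(sqr_sqrtr (ltW a0)) -(sqr_sqrtr (ltW b0)).
move: A0 B0 => /=; set A := Num.sqrt a; set B := Num.sqrt b => A0 B0.
rewrite !sqrtr_sqr !gtr0_norm// ln_div ?posrE// !lnXn//.
move=> /(ler_wpM2l (sqr_ge0 B)).
have -> : B ^+ 2 * (A / B - 1) = A * B - B ^+ 2 by field; rewrite gt_eqF.
rewrite !mulr2n; lra.
Qed.

(** [kl a b] is at most [(a - b) ^ 2 / b], which is [(A - B) ^ 2 * ((A + B) / B) ^ 2] for the square
    roots [A], [B]; since [A <= 2 * B], the last factor is at most [3 ^ 2]. *)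
Lemma kl_le_kl_swap a b : 0 < a -> 0 < b -> a <= 4 * b -> kl a b <= 9 * kl b a.
Proof.
move=> a0 b0 ab; apply: le_trans (ler_wpM2l _ (sqr_sqrtB_le_kl a0 b0)) => //.
have A0 : 0 < Num.sqrt a by rewrite sqrtr_gt0.
have B0 : 0 < Num.sqrt b by rewrite sqrtr_gt0.
have AB : Num.sqrt a <= 2 * Num.sqrt b.
  have -> : 2 = Num.sqrt (2 ^+ 2) :> R by rewrite sqrtr_sqr ger0_norm.
  by rewrite -sqrtrM ?exprn_ge0//; apply: ler_wsqrtr; lra.
have := ln_le_subr1 (divr_gt0 a0 b0); rewrite /kl -ln_div ?posrE//.
rewrite -(sqr_sqrtr (ltW a0)) -(sqr_sqrtr (ltW b0)).
move: A0 B0 AB => /=; set A := Num.sqrt a; set B := Num.sqrt b => A0 B0 AB.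
rewrite !sqrtr_sqr !gtr0_norm//.
move=> /(ler_wpM2l (sqr_ge0 A)) h; apply: le_trans (lerD (lerB h (lexx _)) (lexx _)) _.
have -> : A ^+ 2 * (A ^+ 2 / B ^+ 2 - 1) - A ^+ 2 + B ^+ 2 =
  (A - B) ^+ 2 * ((A + B) / B) ^+ 2 by field; rewrite gt_eqF.
rewrite mulrC ler_wpM2r ?sqr_ge0//.
have q0 : 0 <= (A + B) / B by rewrite divr_ge0 ?addr_ge0 ?ltW.
have q3 : (A + B) / B <= 3 by rewrite ler_pdivrMr//; lra.
nra.
Qed.

(** In this range [A - B >= A / 2] for the square roots, hence [a <= 4 * (A - B) ^ 2]. *)
Lemma le_4kl a b : 0 < a -> 0 < b -> 4 * b < a -> a <= 4 * kl b a.
Proof.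
move=> a0 b0 ab; apply: le_trans (ler_wpM2l _ (sqr_sqrtB_le_kl a0 b0)) => //.
have A0 : 0 < Num.sqrt a by rewrite sqrtr_gt0.
have B0 : 0 < Num.sqrt b by rewrite sqrtr_gt0.
have AB : 2 * Num.sqrt b <= Num.sqrt a.
  have -> : 2 = Num.sqrt (2 ^+ 2) :> R by rewrite sqrtr_sqr ger0_norm.
  by rewrite -sqrtrM ?exprn_ge0//; apply: ler_wsqrtr; lra.
rewrite -{1}(sqr_sqrtr (ltW a0)); nra.
Qed.

End relative_entropy_density.

(** * Integrated inequalities for [kl]: Jensen and change of reference constant *)

Section relative_entropy_integral.
Local Open Scope ereal_scope.
Context d (T : measurableType d) (R : realType).
Context (mu : {measure set T -> \bar R}).
Implicit Types u w h k : T -> R.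

Lemma measurable_kl u w : measurable_fun setT u -> measurable_fun setT w ->
  measurable_fun setT (fun x => kl (u x) (w x)).
Proof.
move=> mu1 mw; apply: measurable_funD => //; apply: measurable_funB => //.
by apply: measurable_funM => //; apply: measurable_funB; exact: measurableT_comp.
Qed.

Lemma ge0_integrable u : measurable_fun setT u -> (forall x, 0 <= u x)%R ->
  \int[mu]_x (u x)%:E < +oo -> mu.-integrable setT (EFin \o u).
Proof.
move=> mu1 u0 uoo; apply/integrableP; split; first exact/measurable_EFinP.
by under eq_integral => x _ do rewrite /= (ger0_norm (u0 x)).
Qed.

Lemma integrable_le_integral h k :
  mu.-integrable setT (EFin \o h) -> measurable_fun setT k ->
  (forall x, 0 <= k x)%R -> (forall x, h x <= k x)%R ->
  \int[mu]_x (h x)%:E <= \int[mu]_x (k x)%:E.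
Proof.
move=> ih mk k0 hk.
have [koo|] := ltP (\int[mu]_x (k x)%:E) +oo; last first.
  by rewrite leye_eq => /eqP ->; exact: leey.
apply: le_integral => //; first exact: ge0_integrable.
by move=> x _; rewrite lee_fin.
Qed.

Lemma integral_affine2 u w (U W a b : R) :
  mu.-integrable setT (EFin \o u) -> mu.-integrable setT (EFin \o w) ->
  \int[mu]_x (u x)%:E = U%:E -> \int[mu]_x (w x)%:E = W%:E ->
  mu.-integrable setT (EFin \o (fun x => u x * a + w x * b)%R) /\
  \int[mu]_x (u x * a + w x * b)%:E = (U * a + W * b)%:E.
Proof.
move=> iu iw uU wW.
have iua : mu.-integrable setT (fun x => (u x)%:E * a%:E).
  exact: integrableZr.
have iwb : mu.-integrable setT (fun x => (w x)%:E * b%:E).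
  exact: integrableZr.
split; first exact: (integrableD _ iua iwb).
under eq_integral do rewrite EFinD !EFinM.
by rewrite integralD// !integralZr// uU wW.
Qed.

(** Integrate [kl_tangent] at the point [(U, W)]. The tangent plane being linear rather than affine,
    the total mass of [mu] does not enter. *)
Lemma kl_jensen u w (U W : R) :
  measurable_fun setT u -> measurable_fun setT w ->
  (forall x, 0 <= u x)%R -> (forall x, 0 < w x)%R -> (0 < U)%R -> (0 < W)%R ->
  \int[mu]_x (u x)%:E = U%:E -> \int[mu]_x (w x)%:E = W%:E ->
  (kl U W)%:E <= \int[mu]_x (kl (u x) (w x))%:E.
Proof.
move=> mu1 mw u0 w0 U0 W0 uU wW.
have iu : mu.-integrable setT (EFin \o u) by apply: ge0_integrable => //; rewrite uU ltry.
have iw : mu.-integrable setT (EFin \o w).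
  by apply: ge0_integrable => [//|x|]; [exact: ltW|rewrite wW ltry].
have [ih hE] := integral_affine2 (ln (U / W)) (1 - U / W) iu iw uU wW.
have -> : kl U W = (U * ln (U / W) + W * (1 - U / W))%R.
  by rewrite /kl ln_div ?posrE//; field; rewrite gt_eqF.
rewrite -hE; apply: integrable_le_integral => //.
- exact: measurable_kl.
- by move=> x; exact: kl_ge0.
- by move=> x; exact: kl_tangent.
Qed.

End relative_entropy_integral.

Section relative_entropy_probability.
Local Open Scope ereal_scope.
Context d (T : measurableType d) (R : realType) (P : probability T R).

(** The difference [kl u b - kl u a] is affine in [u]. When [a] is the mean [m], the added term is
    [kl m b]: this is the chain rule of relative entropy. *)
Lemma kl_compensation (u : T -> R) (m a b : R) :
  measurable_fun setT u -> (forall x, 0 < u x)%R -> (0 < a)%R -> (0 < b)%R ->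
  \int[P]_x (u x)%:E = m%:E -> \int[P]_x (kl (u x) a)%:E < +oo ->
  P.-integrable setT (fun x => (kl (u x) b)%:E) /\
  \int[P]_x (kl (u x) b)%:E =
  \int[P]_x (kl (u x) a)%:E + (m * ln (a / b) - a + b)%:E.
Proof.
move=> mu1 u0 a0 b0 um kloo.
have iu : P.-integrable setT (EFin \o u).
  by apply: ge0_integrable => [//|x|]; [exact: ltW|rewrite um ltry].
have i1 : P.-integrable setT (EFin \o cst (1:R)%R).
  by apply: finite_measure_integrable_cst.
have c1 : \int[P]_x (cst (1:R)%R x)%:E = (1:R)%R%:E.
  rewrite /= integral_cst// mul1e; exact: probability_setT.
have [ih hE] := integral_affine2 (ln (a / b)) (b - a) iu i1 um c1.
have ik : P.-integrable setT (fun x => (kl (u x) a)%:E).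
  apply: ge0_integrable => //; first exact: measurable_kl.
  by move=> x; apply: kl_ge0 => //; exact: ltW.
have klE x : (kl (u x) b)%:E =
    (kl (u x) a)%:E + (u x * ln (a / b) + cst 1 x * (b - a))%:E.
  rewrite -EFinD; congr EFin; rewrite /kl /= ln_div ?posrE//.
  by ring.
under eq_fun do rewrite klE.
split; first exact: (integrableD _ ik ih).
by rewrite integralD// hE; congr (_ + _%:E); ring.
Qed.

End relative_entropy_probability.

(** * Distribution functions and monotone transport on the line *)

Section cumulative.
Context {R : realType}.
Local Notation mu := (@lebesgue_measure R).
Variable w : R -> R.
Implicit Types x y p : R.
Hypotheses (cw : continuous w) (w_gt0 : forall x, 0 < w x)
  (w1 : (\int[mu]_x (w x)%:E = 1)%E).

Definition cumulative x := \int[mu]_(t in `]-oo, x]) w t.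

Let mw : measurable_fun setT w. Proof. exact: continuous_measurable_fun. Qed.

Let iw : mu.-integrable setT (EFin \o w).
Proof. by apply: ge0_integrable => [//|x|]; [exact: ltW|rewrite w1 ltry]. Qed.

Lemma is_derive_cumulative x : is_derive x 1 cumulative (w x).
Proof.
have [||||dF FE] := @continuous_FTC1 R w -oo%O x (x + 1).
- by rewrite ltrDl.
- exact: integrableS iw.
- by rewrite ltNyr.
- exact: cw.
by apply: DeriveDef => //; rewrite -derive1E.
Qed.

Lemma continuous_cumulative : continuous cumulative.
Proof.
move=> x; have [dF _] := is_derive_cumulative x.
exact/differentiable_continuous/derivable1_diffP.
Qed.

Lemma cumulative_incr x y : x < y -> cumulative x < cumulative y.
Proof.
move=> xy; have [||c _] := @MVT R cumulative w x y xy.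
- by move=> z _; exact: is_derive_cumulative.
- exact/continuous_subspaceT/continuous_cumulative.
by move=> E; rewrite -subr_gt0 E mulr_gt0// subr_gt0.
Qed.

Lemma cumulative_lt1 x : 0 < cumulative x < 1.
Proof.
have F01 y : 0 <= cumulative y <= 1.
  have F0 : (0 <= \int[mu]_(t in `]-oo, y]) (w t)%:E)%E.
    by apply: integral_ge0 => t _; rewrite lee_fin ltW.
  have F1 : (\int[mu]_(t in `]-oo, y]) (w t)%:E <= 1)%E.
    rewrite -w1; apply: ge0_subset_integral => //; first exact/measurable_EFinP.
    by move=> t _; rewrite lee_fin ltW.
  have fF : (\int[mu]_(t in `]-oo, y]) (w t)%:E)%E \is a fin_num.
    by rewrite ge0_fin_numE// (le_lt_trans F1)// ltry.
  by rewrite -!lee_fin /cumulative /Rintegral fineK// F0 F1.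
have /andP[_ b] := F01 (x + 1); have /andP[a _] := F01 (x - 1).
rewrite (le_lt_trans a) ?cumulative_incr//; last by rewrite ltrBlDr ltrDl.
by rewrite (lt_le_trans _ b)// cumulative_incr// ltrDl.
Qed.

(** Intermediate values between two points found by contradiction. If [cumulative] stayed below [p],
    monotone convergence along left half-lines would give total mass at most [p < 1]; if it stayed
    above [p], all right half-lines, hence the whole line, would have mass at most [1 - p < 1]. *)
Lemma cumulative_surj p : 0 < p < 1 -> exists x, cumulative x = p.
Proof.
move=> /andP[p0 p1].
have integralE x : (\int[mu]_(t in `]-oo, x]) (w t)%:E)%E = (cumulative x)%:E.
  rewrite /cumulative /Rintegral fineK//; apply: integrable_fin_num => //.
  exact: integrableS iw.
have wpos (A : set R) t : A t -> (0 <= (w t)%:E)%E by move=> _; rewrite lee_fin ltW.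
have mEw (A : set R) : measurable_fun A (EFin \o w).
  exact/measurable_funTS/measurable_EFinP.
have [b pb] : exists b, p <= cumulative b.
  apply: contrapT => /forallNP Fp.
  pose A n := [set` `]-oo, n%:R : R]].
  have nA : nondecreasing_seq A.
    move=> m n mn; apply/subsetPset => x; rewrite /A /= !in_itv/= => /le_trans; apply.
    by rewrite ler_nat.
  have := ge0_nondecreasing_set_cvg_integral (mu := mu) nA
    (fun=> measurable_itv _) (fun i => mEw (A i)) (fun i x => @wpos (A i) x).
  have -> : \bigcup_i A i = setT.
    apply/seteqP; split => // x _; exists (Num.truncn `|x|).+1 => //.
    rewrite /A /= in_itv/=; apply: le_trans (ler_norm x) _.
    by apply/ltW/truncnS_gt.
  rewrite /= w1 => A1.
  have : (1 <= p%:E)%E.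
    rewrite -(cvg_lim _ A1)//; apply: lime_le; first by apply/cvg_ex; exists 1%E.
    near=> n; rewrite /A integralE lee_fin ltW// ltNge.
    by apply/negP/Fp.
  by rewrite lee_fin leNgt p1.
have [a ap] : exists a, cumulative a <= p.
  apply: contrapT => /forallNP Fp.
  pose A n := [set` `](- n%:R : R), +oo[].
  have nA : nondecreasing_seq A.
    move=> m n mn; apply/subsetPset => x; rewrite /A /= !in_itv/= !andbT.
    by apply: le_lt_trans; rewrite lerN2 ler_nat.
  have := ge0_nondecreasing_set_cvg_integral (mu := mu) nA
    (fun=> measurable_itv _) (fun i => mEw (A i)) (fun i x => @wpos (A i) x).
  have -> : \bigcup_i A i = setT.
    apply/seteqP; split => // x _; exists (Num.truncn `|x|).+1 => //.
    rewrite /A /= in_itv/= andbT ltrNl; apply: le_lt_trans (ler_norm _) _.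
    by rewrite normrN truncnS_gt.
  rewrite /= w1 => A1.
  have : (1 <= (1 - p)%:E)%E.
    rewrite -(cvg_lim _ A1)//; apply: lime_le; first by apply/cvg_ex; exists 1%E.
    near=> n.
    have : (\int[mu]_(t in `]-oo, (- n%:R)%R]) (w t)%:E +
        \int[mu]_(t in A n) (w t)%:E)%E = 1%E.
      rewrite -w1 -ge0_integral_setU//=; last 4 first.
      - exact: measurable_itv.
      - exact: mEw.
      - by move=> x _; rewrite lee_fin ltW.
      - by rewrite /A -setCitvl disj_set2E setICr.
      by rewrite /A -setCitvl setUv.
    rewrite integralE => E.
    have : (\int[mu]_(t in A n) (w t)%:E = (1 - cumulative (- n%:R))%:E)%E.
      by rewrite EFinB -E [X in (X - _)%E]addeC addeK.
    move=> ->; rewrite lee_fin lerB// ltW// ltNge.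
    by apply/negP/Fp.
  by rewrite lee_fin lerBrDr gerDl leNgt p0.
have ab : a <= b.
  rewrite leNgt; apply/negP => /cumulative_incr; apply/negP; rewrite -leNgt.
  exact: le_trans ap pb.
have [||c _ <-] := @IVT R cumulative a b p ab.
- exact/continuous_subspaceT/continuous_cumulative.
- have Fab : cumulative a <= cumulative b by exact: le_trans ap pb.
  by rewrite (min_idPl Fab) (max_idPr Fab) ap pb.
by exists c.
Unshelve. all: by end_near. Qed.

End cumulative.

Section monotone_transport.
Context {R : realType}.
Local Notation mu := (@lebesgue_measure R).

(** [T] is the inverse of the second distribution function composed with the first, and its
    derivative is the one-dimensional Monge-Ampere equation. The inverse is obtained by choice on
    ]0, 1[ only, which is enough because distribution functions of positive densities take their
    values there. *)
Lemma monotone_transport (w1 w2 : R -> R) :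
  continuous w1 -> (forall x, 0 < w1 x) -> (\int[mu]_x (w1 x)%:E = 1)%E ->
  continuous w2 -> (forall x, 0 < w2 x) -> (\int[mu]_x (w2 x)%:E = 1)%E ->
  exists T : R -> R, forall x : R, is_derive x 1 T (w1 x / w2 (T x)).
Proof.
move=> c1 p1 i1 c2 p2 i2.
have /choice[g gP] : forall p, exists x, 0 < p < 1 -> cumulative w2 x = p.
  move=> p; have [p01|_] := boolP (0 < p < 1); last by exists 0.
  by have [x xE] := cumulative_surj c2 p2 i2 p01; exists x.
have gK : cancel (cumulative w2) g.
  move=> x; apply: contrapT => /eqP; rewrite neq_lt => /orP[] xy.
  - have := cumulative_incr c2 p2 i2 xy; rewrite gP ?ltxx//.
    exact: cumulative_lt1.
  - have := cumulative_incr c2 p2 i2 xy; rewrite gP ?ltxx//.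
    exact: cumulative_lt1.
exists (g \o cumulative w1) => x.
have gH : cumulative w2 (g (cumulative w1 x)) = cumulative w1 x.
  by rewrite gP//; exact: cumulative_lt1.
have dg : is_derive (cumulative w1 x) 1 g (w2 (g (cumulative w1 x)))^-1.
  rewrite -{1}gH; apply: is_derive_inverse.
  - by near=> y; exact: gK.
  - by near=> y; exact: continuous_cumulative.
  - exact: is_derive_cumulative.
  - by rewrite gt_eqF.
have dh := is_derive_cumulative c1 p1 i1 x.
by apply: is_derive_eq; rewrite mulrC.
Unshelve. all: by end_near. Qed.

End monotone_transport.

(** * The Gaussian log-Sobolev inequality in dimension 1 *)

Section gaussian_density.
Context {R : realType}.
Implicit Types x t : R.

Definition gauss : R -> R := normal_pdf 0 1.

Lemma gaussE x : gauss x = normal_peak 1 * expR (- (x ^+ 2 / 2)).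
Proof.
by rewrite /gauss normal_pdfE ?oner_neq0// /normal_fun subr0 expr1n mulNr.
Qed.

Lemma gauss_gt0 x : 0 < gauss x.
Proof. by rewrite gaussE mulr_gt0 ?expR_gt0// normal_peak_gt0 ?oner_neq0. Qed.

Lemma gauss_ub x : gauss x <= normal_peak 1.
Proof. by rewrite normal_pdf_ub ?oner_neq0. Qed.

Lemma continuous_gauss : continuous gauss.
Proof. exact/continuous_normal_pdf/oner_neq0. Qed.

Lemma ln_gauss x : ln (gauss x) = ln (normal_peak 1) - x ^+ 2 / 2.
Proof.
by rewrite gaussE lnM ?posrE ?expR_gt0 ?normal_peak_gt0 ?oner_neq0// expRK.
Qed.

#[global] Instance is_derive_gauss x : is_derive x 1 gauss (- x * gauss x).
Proof.
rewrite (_ : gauss = fun x => normal_peak 1 * expR (- (x ^+ 2 / 2))); last first.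
  by apply/funext => y; rewrite gaussE.
apply: is_derive_eq.
by rewrite /GRing.scale /=; field.
Qed.

End gaussian_density.

Section gaussian_log_sobolev_1d.
Context {R : realType}.
Local Notation mu := (@lebesgue_measure R).
Variables (f f' : R -> R) (m : R).
Hypotheses (f_gt0 : forall x, 0 < f x) (m_gt0 : 0 < m)
  (df : forall x : R, is_derive x 1 f (f' x)) (cf' : continuous f').
Hypothesis fm : (\int[mu]_x (f x ^+ 2 * gauss x)%:E = m%:E)%E.

Let W x := f x ^+ 2 / m.
Let w x := W x * gauss x.

Let W_gt0 x : 0 < W x. Proof. by rewrite divr_gt0// exprn_gt0. Qed.

Let cf : continuous f.
Proof.
by move=> x; have [? _] := df x; exact/differentiable_continuous/derivable1_diffP.
Qed.

Let cf2 : continuous (fun x => f x ^+ 2).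
Proof. by move=> x; apply: cvgM; exact: cf. Qed.

Let cW : continuous W.
Proof. by move=> x; apply: cvgM; [exact: cf2|exact: cvg_cst]. Qed.

Let cw : continuous w.
Proof. by move=> x; apply: cvgM; [exact: cW|exact: continuous_gauss]. Qed.

Let w_gt0 x : 0 < w x. Proof. by rewrite mulr_gt0// gauss_gt0. Qed.

Let w1 : (\int[mu]_x (w x)%:E = 1)%E.
Proof.
have wE x : (w x)%:E = ((m^-1)%:E * (f x ^+ 2 * gauss x)%:E)%E.
  by rewrite -EFinM /w /W; congr EFin; ring.
under eq_integral do rewrite wE.
rewrite ge0_integralZl//.
- by rewrite fm -EFinM mulVf// gt_eqF.
- apply/measurable_EFinP; apply: continuous_measurable_fun => x.
  by apply: cvgM; [exact: cf2|exact: continuous_gauss].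
- by move=> x _; rewrite lee_fin mulr_ge0 ?exprn_ge0 ?(ltW (gauss_gt0 _))// ltW.
- by rewrite lee_fin invr_ge0 ltW.
Qed.

Section with_transport.
Variable T : R -> R.
Hypothesis dT : forall x : R, is_derive x 1 T (w x / gauss (T x)).

(* [kl (f ^ 2) m * gauss - 2 * f' ^ 2 * gauss] is at most the derivative of
   [B]; the inequality is [ln (T') <= T' - 1] and a completed square. *)
Let B x := m * (w x * (T x - x) - (cumulative w x - cumulative gauss x)).
Let B' x := 2 * f x * f' x * gauss x * (T x - x) - m * x * w x * (T x - x)
  + m * w x * (w x / gauss (T x) - 1) - m * w x + m * gauss x.

Let integral_gauss1 : (\int[mu]_x (gauss x)%:E = 1)%E.
Proof. exact: integral_normal_pdf. Qed.

Let dB (x : R) : is_derive x 1 B (B' x).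
Proof.
have d4 := dT x; have d3 := df x.
have d2 := is_derive_cumulative cw w_gt0 w1 x.
have d1 := is_derive_cumulative continuous_gauss gauss_gt0 integral_gauss1 x.
apply: is_derive_eq.
rewrite /GRing.scale /= /B' /w /W; field.
by rewrite !gt_eqF// gauss_gt0.
Qed.

Let kl_le_B' (x : R) :
  kl (f x ^+ 2) m * gauss x <= 2 * f' x ^+ 2 * gauss x + B' x.
Proof.
set t := T x; set q := w x / gauss t.
have q_gt0 : 0 < q by rewrite divr_gt0// gauss_gt0.
have lnq : ln q = ln (W x) - x ^+ 2 / 2 + t ^+ 2 / 2.
  rewrite ln_div ?posrE ?gauss_gt0// lnM ?posrE ?gauss_gt0// !ln_gauss.
  by ring.
have lnW : ln (W x) <= - (t - x) * x - (t - x) ^+ 2 / 2 + q - 1.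
  by have := ln_le_subr1 q_gt0; rewrite lnq; nra.
have fW : f x ^+ 2 = m * W x by rewrite /W; field; rewrite gt_eqF.
have -> : kl (f x ^+ 2) m = m * W x * ln (W x) - m * W x + m.
  by rewrite /kl -ln_div ?posrE ?exprn_gt0// -/(W x) fW.
have -> : B' x = (2 * f x * f' x * (t - x) - m * x * W x * (t - x)
  + m * W x * (q - 1) - m * W x + m) * gauss x.
  by rewrite /B' -/t -/q /w; ring.
rewrite -mulrDl ler_pM2r ?gauss_gt0//.
have := ler_wpM2l (ltW (mulr_gt0 m_gt0 (W_gt0 x))) lnW.
(* After division by [gauss x], the gap left by [lnW] is half of this square, since
   [m * W x = f x ^ 2]: the quadratic term [(t - x) ^ 2 / 2] absorbs the cross term
   [2 * f * f' * (t - x)] at the cost [2 * f' ^ 2]. *)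
have := sqr_ge0 (f x * (t - x) + 2 * f' x).
by rewrite sqrrD !exprMn fW !mulr2n; nra.
Qed.

Let continuous_T : continuous T.
Proof.
by move=> x; have [? _] := dT x; exact/differentiable_continuous/derivable1_diffP.
Qed.

Let continuous_B : continuous B.
Proof.
by move=> x; have [? _] := dB x; exact/differentiable_continuous/derivable1_diffP.
Qed.

Let continuous_B' : continuous B'.
Proof.
have cT x : {for x, continuous (fun x => T x - x)}.
  by apply: cvgB; [exact: continuous_T|exact: cvg_id].
have cid x : {for x, continuous (fun x : R => x)} by exact: cvg_id.
move=> x; apply: cvgD; [|by apply: cvgM; [exact: cvg_cst|exact: continuous_gauss]].
apply: cvgB; [|by apply: cvgM; [exact: cvg_cst|exact: cw]].
apply: cvgD.
  apply: cvgB.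
    apply: cvgM; last exact: cT.
    apply: cvgM; last exact: continuous_gauss.
    apply: cvgM; last exact: cf'.
    by apply: cvgM; [exact: cvg_cst|exact: cf].
  apply: cvgM; last exact: cT.
  apply: cvgM; last exact: cw.
  by apply: cvgM; [exact: cvg_cst|exact: cid].
apply: cvgM; first by apply: cvgM; [exact: cvg_cst|exact: cw].
apply: cvgB; last exact: cvg_cst.
apply: cvgM; first exact: cw.
apply: cvgV; first by rewrite gt_eqF// gauss_gt0.
by apply: continuous_comp; [exact: continuous_T|exact: continuous_gauss].
Qed.

(* The boundary terms cannot stay bounded away from 0 because the derivative
   of [gauss \o T] is [- T * w], while [gauss] is bounded. *)
Let dgT (x : R) : is_derive x 1 (gauss \o T) (- T x * w x).
Proof.
have d := dT x; apply: is_derive_eq.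
by field; rewrite gt_eqF// gauss_gt0.
Qed.

(** Mean value theorem for [gauss \o T]: on a long interval where [T * w] stays large, this function
    would vary by more than its range ]0, [normal_peak 1]] allows. *)
Let width_le (a b e : R) : a <= b ->
  (forall x, a < x < b -> e <= `|T x * w x|) -> e * (b - a) <= normal_peak 1.
Proof.
move=> ab ew; rewrite le_eqVlt in ab; case/predU1P: ab => [->|ab].
  by rewrite subrr mulr0 normal_peak_ge0.
have [||c cab E] := @MVT R (gauss \o T) (fun x => - T x * w x) a b ab.
- by move=> x _; exact: dgT.
- apply: continuous_subspaceT => x.
  by apply: continuous_comp; [exact: continuous_T|exact: continuous_gauss].
have ba : 0 < b - a by rewrite subr_gt0.
have : `|(gauss \o T) b - (gauss \o T) a| <= normal_peak 1.
  rewrite ler_norml /=.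
  have := gauss_ub (T a); have := gauss_ub (T b).
  have := gauss_gt0 (T a); have := gauss_gt0 (T b); lra.
rewrite E normrM mulNr normrN (gtr0_norm ba); apply: le_trans.
by rewrite ler_pM2r// ew//; move: cab; rewrite in_itv.
Qed.

(** Otherwise [w * (T - x)] exceeds [e] beyond [b0]; at nonnegative points [T * w] then exceeds [e]
    as well, on an interval of length [(normal_peak 1 + 1) / e], which [width_le] forbids. Only
    arbitrarily distant good points are obtained, not a limit at infinity. *)
Let boundary_right (b0 e : R) : 0 < e ->
  exists2 b, b0 <= b & w b * (T b - b) <= e.
Proof.
move=> e0; apply: contrapT => H.
pose a := Num.max b0 0; pose b := a + (normal_peak 1 + 1) / e.
have ab : a <= b by rewrite lerDl divr_ge0 ?addr_ge0 ?normal_peak_ge0 ?ltW.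
have : e * (b - a) <= normal_peak 1.
  apply: width_le => // x /andP[ax _]; apply: le_trans (ler_norm _).
  have [b0x x0] : b0 <= x /\ 0 <= x.
    by move: ax; rewrite gt_max => /andP[/ltW ? /ltW].
  have : e < w x * (T x - x) by rewrite ltNge; apply/negP => h; apply: H; exists x.
  have := mulr_ge0 x0 (ltW (w_gt0 x)); nra.
have -> : e * (b - a) = normal_peak 1 + 1 by rewrite /b; field; rewrite gt_eqF.
by rewrite gerDl leNgt ltr01.
Qed.

Let boundary_left (a0 e : R) : 0 < e ->
  exists2 a, a <= a0 & - e <= w a * (T a - a).
Proof.
move=> e0; apply: contrapT => H.
pose b := Num.min a0 0; pose a := b - (normal_peak 1 + 1) / e.
have ab : a <= b by rewrite lerBlDr lerDl divr_ge0 ?addr_ge0 ?normal_peak_ge0 ?ltW.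
have : e * (b - a) <= normal_peak 1.
  apply: width_le => // x /andP[_ xb]; rewrite -normrN.
  apply: le_trans (ler_norm _).
  have [b0x x0] : x <= a0 /\ x <= 0.
    by move: xb; rewrite lt_min => /andP[/ltW ? /ltW].
  have : w x * (T x - x) < - e by rewrite ltNge; apply/negP => h; apply: H; exists x.
  have := mulr_le0_ge0 x0 (ltW (w_gt0 x)); nra.
have -> : e * (b - a) = normal_peak 1 + 1 by rewrite /a; field; rewrite gt_eqF.
by rewrite gerDl leNgt ltr01.
Qed.

Let B_le (b0 e : R) : 0 < e -> exists2 b, b0 <= b & B b <= e.
Proof.
(* [B] carries the factor [m], so each of its two parts, the boundary term and the difference of
   distribution functions, may contribute [e / m / 2]. *)
move=> e0; have e2 : 0 < e / m / 2 by rewrite !divr_gt0.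
have [b1 Hb1] : exists b1, 1 - e / m / 2 <= cumulative w b1.
  have [e1|e1] := ltP (e / m / 2) 1; last first.
    exists 0; apply: le_trans (_ : 0 <= _); first by rewrite subr_le0.
    by have /andP[/ltW] := cumulative_lt1 cw w_gt0 w1 0.
  have [|b1 <-] := cumulative_surj cw w_gt0 w1 (p := 1 - e / m / 2); last by exists b1.
  by rewrite subr_gt0 e1 gtrBl.
have [b b1b Hb] := boundary_right (Num.max b0 b1) e2.
move: b1b; rewrite ge_max => /andP[b0b b1b]; exists b => //.
have /andP[_ Gb] := cumulative_lt1 continuous_gauss gauss_gt0 integral_gauss1 b.
have Fb : cumulative w b1 <= cumulative w b.
  move: b1b; rewrite le_eqVlt => /predU1P[->//|].
  by move=> /(cumulative_incr cw w_gt0 w1) /ltW.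
rewrite /B -ler_pdivlMl//.
by rewrite mulrC; lra.
Qed.

Let B_ge (a0 e : R) : 0 < e -> exists2 a, a <= a0 & - e <= B a.
Proof.
move=> e0; have e2 : 0 < e / m / 2 by rewrite !divr_gt0.
have [b1 Hb1] : exists b1, cumulative w b1 <= e / m / 2.
  have [e1|e1] := ltP (e / m / 2) 1; last first.
    exists 0; apply: le_trans e1.
    by have /andP[_ /ltW] := cumulative_lt1 cw w_gt0 w1 0.
  have [|b1 <-] := cumulative_surj cw w_gt0 w1 (p := e / m / 2); last by exists b1.
  by rewrite e2.
have [a ab1 Ha] := boundary_left (Num.min a0 b1) e2.
move: ab1; rewrite le_min => /andP[aa0 ab1]; exists a => //.
have /andP[Ga _] := cumulative_lt1 continuous_gauss gauss_gt0 integral_gauss1 a.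
have Fa : cumulative w a <= cumulative w b1.
  move: ab1; rewrite le_eqVlt => /predU1P[->//|].
  by move=> /(cumulative_incr cw w_gt0 w1) /ltW.
rewrite /B -ler_pdivrMl// mulrN mulrC; lra.
Qed.

Local Open Scope ereal_scope.

Let klg x := (kl (f x ^+ 2) m * gauss x)%R.
Let J x := (2 * f' x ^+ 2 * gauss x)%R.

Let klg_ge0 x : (0 <= klg x)%R.
Proof. exact: mulr_ge0 (kl_ge0 (sqr_ge0 _) m_gt0) (ltW (gauss_gt0 x)). Qed.

Let J_ge0 x : (0 <= J x)%R.
Proof.
exact: mulr_ge0 (mulr_ge0 (ler0n _ 2) (sqr_ge0 _)) (ltW (gauss_gt0 x)).
Qed.

Let mklg : measurable_fun setT klg.
Proof.
apply: measurable_funM; last exact: continuous_measurable_fun continuous_gauss.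
apply: measurable_kl => //; exact: continuous_measurable_fun cf2.
Qed.

Let cJ : continuous J.
Proof.
move=> x; apply: cvgM; last exact: continuous_gauss.
by apply: cvgM; [exact: cvg_cst|apply: cvgM; exact: cf'].
Qed.

Let mJ : measurable_fun setT J. Proof. exact: continuous_measurable_fun. Qed.

Let integral_klg_itv (a b : R) : (a < b)%R ->
  \int[mu]_(x in `[a, b]) (klg x)%:E <= \int[mu]_x (J x)%:E + (B b - B a)%:E.
Proof.
move=> ab.
have FTC : \int[mu]_(x in `[a, b]) (B' x)%:E = (B b - B a)%:E.
  rewrite (@continuous_FTC2 _ B' B)//.
  - exact: continuous_subspaceT.
  - split.
    + by move=> x _; have [] := dB x.
    + by apply: cvg_at_right_filter; exact: continuous_B.
    + by apply: cvg_at_left_filter; exact: continuous_B.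
  - by move=> x _; have [_] := dB x; rewrite derive1E.
have iB' : mu.-integrable `[a, b] (EFin \o B').
  apply: continuous_compact_integrable; first exact: segment_compact.
  exact: continuous_subspaceT.
have iJ : mu.-integrable `[a, b] (EFin \o J).
  apply: continuous_compact_integrable; first exact: segment_compact.
  exact: continuous_subspaceT.
apply: (@le_trans _ _ (\int[mu]_(x in `[a, b]) ((J x)%:E + (B' x)%:E))).
  apply: ge0_le_integral => //=.
  - by move=> x _; rewrite lee_fin.
  - exact/measurable_funTS/measurable_EFinP.
  - by apply/measurable_funTS/emeasurable_funD; apply/measurable_EFinP;
      [|exact: continuous_measurable_fun].
  - by move=> x _; rewrite -EFinD lee_fin; exact: kl_le_B'.
rewrite integralD//= FTC leeD2r//.
apply: ge0_subset_integral => //=; first exact/measurable_EFinP.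
by move=> x _; rewrite lee_fin.
Qed.

(** The integral over [[-n, n]] of the nonnegative left integrand is bounded by the one over a
    larger [[a, b]] whose endpoints are chosen so that [B b - B a] is at most [e]. One-sided bounds
    on [B] at suitable points therefore suffice. *)
Lemma integral_kl_le_of_transport :
  \int[mu]_x (kl (f x ^+ 2) m * gauss x)%:E <=
  \int[mu]_x (2 * f' x ^+ 2 * gauss x)%:E.
Proof.
pose A n := [set` `[(- n%:R : R), n%:R]%R].
have nA : nondecreasing_seq A.
  move=> k n kn; apply/subsetPset => x; rewrite /A /= !in_itv/= => /andP[h1 h2].
  by rewrite (le_trans _ h1) ?(le_trans h2) ?lerN2 ?ler_nat.
have mA i : measurable_fun (A i) (EFin \o klg).
  exact/measurable_funTS/measurable_EFinP.
have A0 i x : A i x -> 0 <= (klg x)%:E by rewrite lee_fin.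
have := ge0_nondecreasing_set_cvg_integral (mu := mu) nA (fun=> measurable_itv _) mA A0.
have -> : \bigcup_i A i = setT.
  apply/seteqP; split => // x _; exists (Num.truncn `|x|).+1 => //.
  rewrite /A /= in_itv/= -ler_norml; exact/ltW/truncnS_gt.
move=> cvgA; rewrite -(cvg_lim _ cvgA)//; apply: lime_le.
  by apply/cvg_ex; eexists; exact: cvgA.
apply: nearW => n; apply/lee_addgt0Pr => e e0.
have e2 : (0 < e / 2)%R by rewrite divr_gt0.
(* The [+ 1] keeps [a < b] when [n = 0]. *)
have [b nb Bb] := B_le (n%:R + 1) e2.
have [a na Ba] := B_ge (- n%:R) e2.
have ab : (a < b)%R.
  rewrite (le_lt_trans na)// (lt_le_trans _ nb)// (@le_lt_trans _ _ n%:R)//.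
    by rewrite lerNl (le_trans _ (ler0n _ n))// oppr_le0.
  by rewrite ltrDl.
apply: le_trans (_ : \int[mu]_(x in `[a, b]) (klg x)%:E <= _).
  apply: ge0_subset_integral => //=.
  - exact: measurable_itv.
  - exact/measurable_funTS/measurable_EFinP.
  - by move=> x _; rewrite lee_fin.
  move=> x; rewrite /A /= !in_itv/= => /andP[h1 h2].
  by rewrite (le_trans na h1) (le_trans h2)// (le_trans _ nb)// lerDl.
apply: le_trans (integral_klg_itv ab) _.
by rewrite leeD2l// lee_fin; lra.
Unshelve. all: by end_near. Qed.

End with_transport.

Lemma integral_kl_le_gauss :
  (\int[mu]_x (kl (f x ^+ 2) m * gauss x)%:E <=
   \int[mu]_x (2 * f' x ^+ 2 * gauss x)%:E)%E.
Proof.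
have [T dT] := monotone_transport cw w_gt0 w1 continuous_gauss gauss_gt0
  (integral_normal_pdf 0 1).
exact: integral_kl_le_of_transport dT.
Qed.

End gaussian_log_sobolev_1d.

(** * Integration against densities and affine changes of variable *)

Section density.
Local Open Scope ereal_scope.
Context d (T : measurableType d) (R : realType).
Context (nu : {finite_measure set T -> \bar R})
  (mu : {sigma_finite_measure set T -> \bar R}) (p : T -> R).
Hypotheses (mp : measurable_fun setT p) (p0 : forall x, (0 <= p x)%R).
Hypothesis nuE : forall A, measurable A -> nu A = \int[mu]_(x in A) (p x)%:E.

Lemma ge0_integral_density (h : T -> \bar R) :
  measurable_fun setT h -> (forall x, 0 <= h x) ->
  \int[nu]_x h x = \int[mu]_x (h x * (p x)%:E).
Proof.
move=> mh h0.
have numu : nu `<< mu.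
  apply/null_content_dominatesP => A mA muA0; rewrite nuE//.
  by apply: null_set_integral => //; exact/measurable_funTS/measurable_EFinP.
rewrite -(Radon_Nikodym_SigmaFinite.change_of_variables numu)//.
apply: ge0_ae_eq_integral => //.
- apply: emeasurable_funM => //; apply: (measurable_int mu).
  exact: Radon_Nikodym_SigmaFinite.f_integrable.
- by apply: emeasurable_funM => //; exact/measurable_EFinP.
- by move=> x _; rewrite mule_ge0// Radon_Nikodym_SigmaFinite.f_ge0.
- by move=> x _; rewrite mule_ge0// lee_fin.
- apply: ae_eqe_mul2l; apply: integral_ae_eq => //.
  + exact: Radon_Nikodym_SigmaFinite.f_integrable.
  + exact/measurable_EFinP.
  + move=> E _ mE; rewrite -nuE//.
    by rewrite -Radon_Nikodym_SigmaFinite.f_integral.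
Qed.

End density.

Section affine_map.
Context {R : realType} (c v : R).

Definition affine (x : R) : measurableTypeR R := c * x - v.

Let measurable_affine : measurable_fun setT affine.
Proof. by apply: measurable_funB => //; exact: measurable_funM. Qed.

HB.instance Definition _ := isMeasurableFun.Build _ _ _ _ affine measurable_affine.

Definition affine_image := pushforward (@lebesgue_measure R) affine.

Let affine_image0 : affine_image set0 = 0%E. Proof. exact: measure0. Qed.

Let affine_image_ge0 A : (0 <= affine_image A)%E. Proof. exact: measure_ge0. Qed.

Let affine_image_sigma_additive : semi_sigma_additive affine_image.
Proof. exact: measure_semi_sigma_additive. Qed.

HB.instance Definition _ := isMeasure.Build _ _ _ affine_image
  affine_image0 affine_image_ge0 affine_image_sigma_additive.

Hypothesis c_gt0 : 0 < c.

Lemma lebesgue_measure_affine A : measurable A ->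
  (c%:E * affine_image A = lebesgue_measure A)%E.
Proof.
pose m := mscale (NngNum (ltW c_gt0)) affine_image.
move=> mA; rewrite -[LHS]/(m A); apply/esym/lebesgue_measure_unique => //.
move=> _ [[a b]] _ <-.
have pre : affine @^-1` `]a, b] = [set` `]((a + v) / c), ((b + v) / c)]].
  apply/seteqP; split => x /=; rewrite /affine !in_itv/=.
    by rewrite ltrBrDr lerBlDr ltr_pdivrMr// ler_pdivlMr// mulrC.
  by rewrite ltrBrDr lerBlDr ltr_pdivrMr// ler_pdivlMr// mulrC.
rewrite -[RHS]/(c%:E * lebesgue_measure (affine @^-1` `]a, b]))%E pre.
rewrite !lebesgue_measure_itv/= !lte_fin ltr_pM2r ?invr_gt0// ltrD2r.
case: ifPn => ab; last by rewrite mule0.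
by rewrite -!EFinB -EFinM; congr EFin; field; rewrite gt_eqF.
Qed.

Lemma ge0_integral_affine (h : R -> \bar R) :
  measurable_fun setT h -> (forall x, 0 <= h x)%E ->
  (c%:E * \int[lebesgue_measure]_x h (c * x - v)%R = \int[lebesgue_measure]_x h x)%E.
Proof.
move=> mh h0.
pose m := mscale (NngNum (ltW c_gt0)) affine_image.
transitivity (\int[m]_x h x)%E.
  by rewrite ge0_integral_mscale//= /affine_image ge0_integral_pushforward.
by apply: eq_measure_integral => A mA _; exact: lebesgue_measure_affine.
Qed.

End affine_map.

Section gaussian_measure_1d.
Context {R : realType}.
Local Notation N := (normal_prob (0 : R) 1).
Local Notation mu := (@lebesgue_measure R).

Lemma integral_normal_prob (h : R -> \bar R) :
  measurable_fun setT h -> (forall x, 0 <= h x)%E ->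
  (\int[N]_x h x = \int[mu]_x (h x * (gauss x)%:E))%E.
Proof.
move=> mh h0; apply: ge0_integral_density => //.
- exact: measurable_normal_pdf.
- by move=> x; rewrite normal_pdf_ge0.
Qed.

(** Density, with respect to the standard Gaussian, of the law of [c * X - v] for [X] standard
    Gaussian. *)
Definition tilt1 (c v x : R) := c^-1 * expR (x ^+ 2 / 2 - ((x + v) / c) ^+ 2 / 2).

Lemma continuous_tilt1 c v : continuous (tilt1 c v).
Proof.
have h x : derivable (tilt1 c v) x 1 by rewrite /tilt1; apply: ex_derive.
by move=> x; exact/differentiable_continuous/derivable1_diffP.
Qed.

Lemma integral_tilt1 (c v : R) (h : R -> \bar R) : 0 < c ->
  measurable_fun setT h -> (forall x, 0 <= h x)%E ->
  (\int[N]_x h (c * x - v)%R = \int[N]_x (h x * (tilt1 c v x)%:E))%E.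
Proof.
move=> c0 mh h0.
have maff : measurable_fun setT (fun x : R => (x + v) / c : R).
  by apply: measurable_funM => //; exact: measurable_funD.
have maff' : measurable_fun setT (fun x : R => c * x - v : R).
  by apply: measurable_funB => //; exact: measurable_funM.
have mg := measurable_normal_pdf (0 : R) 1.
have mt : measurable_fun setT (tilt1 c v).
  by apply: continuous_measurable_fun; exact: continuous_tilt1.
rewrite [LHS]integral_normal_prob//; last exact: measurableT_comp mh maff'.
rewrite [RHS]integral_normal_prob; last 2 first.
- by apply: emeasurable_funM => //; exact/measurable_EFinP.
- by move=> x; rewrite mule_ge0// lee_fin mulr_ge0 ?expR_ge0// invr_ge0 ltW.
have kE x : (h x * (tilt1 c v x)%:E * (gauss x)%:E =
    (c^-1)%:E * (h x * (gauss ((x + v) / c))%:E))%E.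
  rewrite muleCA -muleA -!EFinM; congr (_ * _%:E)%E.
  rewrite !gaussE /tilt1.
  have -> : expR (- (((x + v) / c) ^+ 2 / 2)) =
      expR (x ^+ 2 / 2 - ((x + v) / c) ^+ 2 / 2) * expR (- (x ^+ 2 / 2)).
    by rewrite -expRD; congr expR; ring.
  by ring.
under [RHS]eq_integral do rewrite kE.
have mk : measurable_fun setT (fun x => h x * (gauss ((x + v) / c))%:E)%E.
  apply: emeasurable_funM => //; apply/measurable_EFinP.
  exact: measurableT_comp mg maff.
have k0 x : (0 <= h x * (gauss ((x + v) / c))%:E)%E.
  by rewrite mule_ge0// lee_fin ltW// gauss_gt0.
rewrite ge0_integralZl//; last by rewrite lee_fin invr_ge0 ltW.
rewrite -(ge0_integral_affine v c0 mk k0) muleA -EFinM mulVf ?gt_eqF// mul1e.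
apply: eq_integral => x _; congr (_ * (gauss _)%:E)%E.
by field; rewrite gt_eqF.
Qed.

Lemma gaussian_log_sobolev_1d (f f' : R -> R) (m : R) :
  (forall x, 0 < f x) -> 0 < m -> (forall x : R, is_derive x 1 f (f' x)) ->
  continuous f' -> (\int[N]_x (f x ^+ 2)%:E = m%:E)%E ->
  (\int[N]_x (kl (f x ^+ 2) m)%:E <= \int[N]_x (2 * f' x ^+ 2)%:E)%E.
Proof.
move=> f0 m0 df cf' fm.
have mf : measurable_fun setT f.
  apply: continuous_measurable_fun => x; have [? _] := df x.
  exact/differentiable_continuous/derivable1_diffP.
have mf2 : measurable_fun setT (fun x => f x ^+ 2) by exact: measurable_funX.
have mf' : measurable_fun setT f' by exact: continuous_measurable_fun.
rewrite !integral_normal_prob//.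
- under eq_integral do rewrite -EFinM.
  under [leRHS]eq_integral do rewrite -EFinM.
  apply: integral_kl_le_gauss => //.
  rewrite -fm integral_normal_prob//.
    exact/measurable_EFinP.
  by move=> x; rewrite lee_fin sqr_ge0.
- by apply/measurable_EFinP; apply: measurable_funM => //; exact: measurable_funX.
- by move=> x; rewrite lee_fin mulr_ge0 ?sqr_ge0.
- exact/measurable_EFinP/measurable_kl.
- by move=> x; rewrite lee_fin kl_ge0 ?sqr_ge0.
Qed.

End gaussian_measure_1d.

(** * The standard Gaussian measure on row vectors *)

Section gaussian_measure_rV_step.
Context {R : realType} (n : nat) (mu : probability 'rV[R]_n R).
Local Notation N := (normal_prob (0 : R) 1).

Definition gauss_rV_step : set 'rV[R]_n.+1 -> \bar R :=
  pushforward (N \x mu)%E (@rV_cons R n).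

Let gauss_rV_step0 : gauss_rV_step set0 = 0%E.
Proof. by apply: measure0; exact: measurable_rV_cons. Qed.

Let gauss_rV_step_ge0 A : (0 <= gauss_rV_step A)%E.
Proof. by apply: measure_ge0; exact: measurable_rV_cons. Qed.

Let gauss_rV_step_sigma_additive : semi_sigma_additive gauss_rV_step.
Proof. by apply: measure_semi_sigma_additive; exact: measurable_rV_cons. Qed.

HB.instance Definition _ := isMeasure.Build _ _ _ gauss_rV_step
  gauss_rV_step0 gauss_rV_step_ge0 gauss_rV_step_sigma_additive.

Let gauss_rV_stepT : gauss_rV_step setT = 1%E.
Proof.
rewrite /gauss_rV_step /pushforward preimage_setT -setXTT product_measure1E//.
rewrite -[RHS]mule1; congr (_ * _)%E; last exact: probability_setT.
exact: (@probability_setT _ _ _ N).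
Qed.

HB.instance Definition _ :=
  Measure_isProbability.Build _ _ _ gauss_rV_step gauss_rV_stepT.

End gaussian_measure_rV_step.

Section gaussian_measure_rV.
Context {R : realType}.
Local Notation N := (normal_prob (0 : R) 1).
Local Notation leb := (@lebesgue_measure R).

(** The recursion mirrors that of [lebesgue_rV]: splitting off the first coordinate serves both the
    identification with [std_normal_pdf] and the tensorization. *)
Fixpoint gauss_rV n : probability 'rV[R]_n R :=
  match n with
  | 0 => dirac (0 : 'rV[R]_0)
  | n.+1 => gauss_rV_step (gauss_rV n)
  end.

Local Open Scope ereal_scope.

Lemma measurable_comp_rV_cons n (h : 'rV[R]_n.+1 -> \bar R) :
  measurable_fun setT h -> measurable_fun setT (h \o @rV_cons R n).
Proof. by move=> mh; apply: measurableT_comp => //; exact: measurable_rV_cons. Qed.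

Lemma integral_gauss_rVS n (h : 'rV[R]_n.+1 -> \bar R) :
  measurable_fun setT h -> (forall x, 0 <= h x) ->
  \int[gauss_rV n.+1]_z h z = \int[N]_x \int[gauss_rV n]_v h (rV_cons (x, v)).
Proof.
move=> mh h0; rewrite /= /gauss_rV_step ge0_integral_pushforward//=.
  by rewrite fubini_tonelli1//=; exact: measurable_comp_rV_cons.
exact: measurable_rV_cons.
Qed.

Lemma integral_lebesgue_rVS n (h : 'rV[R]_n.+1 -> \bar R) :
  measurable_fun setT h -> (forall x, 0 <= h x) ->
  \int[lebesgue_rV n.+1]_z h z =
  \int[leb]_x \int[lebesgue_rV n]_v h (rV_cons (x, v)).
Proof.
move=> mh h0; rewrite /= /lebesgue_rV_step ge0_integral_pushforward//=.
  by rewrite fubini_tonelli1//=; exact: measurable_comp_rV_cons.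
exact: measurable_rV_cons.
Qed.

Lemma measurable_fun_rV_cons_fst n (h : 'rV[R]_n.+1 -> \bar R) x :
  measurable_fun setT h -> measurable_fun setT (fun v => h (rV_cons (x, v))).
Proof.
move=> mh; apply: measurableT_comp (measurable_comp_rV_cons mh) _.
exact: measurable_pair1.
Qed.

Lemma measurable_integral_gauss_rV n (h : 'rV[R]_n.+1 -> \bar R) :
  measurable_fun setT h -> (forall x, 0 <= h x) ->
  measurable_fun setT (fun x => \int[gauss_rV n]_v h (rV_cons (x, v))).
Proof.
move=> mh h0; apply: (measurable_fun_fubini_tonelli_F (h \o @rV_cons R n)).
- exact: measurable_comp_rV_cons.
- by move=> p; exact: h0.
Qed.

Lemma eucl_norm_sqr n (x : 'rV[R]_n) :
  (eucl_norm x ^+ 2 = \sum_(i < n) x 0 i ^+ 2)%R.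
Proof. by rewrite sqr_sqrtr// sumr_ge0// => i _; exact: sqr_ge0. Qed.

Lemma measurable_eucl_norm_sqr n :
  measurable_fun setT (fun x : 'rV[R]_n => eucl_norm x ^+ 2)%R.
Proof.
under eq_fun do rewrite eucl_norm_sqr.
by apply: measurable_sum => i; apply: measurable_funX; exact: measurable_coord.
Qed.

Lemma measurable_std_normal_pdf n : measurable_fun setT (@std_normal_pdf R n).
Proof.
apply: measurable_funM => //; apply: measurableT_comp => //.
apply: measurableT_comp => //; apply: measurable_funM => //.
exact: measurable_eucl_norm_sqr.
Qed.

Lemma eucl_norm_rV_cons n (x : R) (v : 'rV[R]_n) :
  (eucl_norm (rV_cons (x, v)) ^+ 2 = x ^+ 2 + eucl_norm v ^+ 2)%R.
Proof.
rewrite !eucl_norm_sqr big_ord_recl rV_cons0; congr +%R.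
by apply: eq_bigr => i _; rewrite rV_consS.
Qed.

Lemma std_normal_pdf_ge0 n (x : 'rV[R]_n) : (0 <= std_normal_pdf x)%R.
Proof. by rewrite mulr_ge0 ?expR_ge0 ?powR_ge0. Qed.

Lemma std_normal_pdf_rV_cons n (x : R) (v : 'rV[R]_n) :
  std_normal_pdf (rV_cons (x, v)) = (gauss x * std_normal_pdf v)%R.
Proof.
have pi2 : (0 < 2 * pi :> R)%R by rewrite mulr_gt0// pi_gt0.
rewrite /std_normal_pdf eucl_norm_rV_cons gaussE.
have -> : normal_peak 1 = ((2 * pi) `^ (- 2^-1))%R :> R.
  rewrite /normal_peak expr1n mul1r -[in LHS]mulr_natl powRN powR12_sqrt//.
  exact: ltW.
have -> : (- ((x ^+ 2 + eucl_norm v ^+ 2) / 2) =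
  - (x ^+ 2 / 2) + - (eucl_norm v ^+ 2 / 2))%R by ring.
have -> : (- (n.+1%:R / 2) = - 2^-1 + - (n%:R / 2) :> R)%R.
  by rewrite -natr1; ring.
rewrite expRD powRD; last by rewrite (gt_eqF pi2) implybT.
by ring.
Qed.

Lemma integral_std_normal_pdf n (h : 'rV[R]_n -> \bar R) :
  measurable_fun setT h -> (forall x, 0 <= h x) ->
  \int[lebesgue_rV n]_x (h x * (std_normal_pdf x)%:E) = \int[gauss_rV n]_x h x.
Proof.
elim: n h => [|n IH] h mh h0.
  rewrite !integral_dirac//; last first.
    apply: emeasurable_funM => //.
    by apply/measurable_EFinP; exact: measurable_std_normal_pdf.
  rewrite !diracT !mul1e /std_normal_pdf eucl_norm_sqr big_ord0 !mul0r oppr0.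
  by rewrite powRr0 expR0 mulr1 mule1.
have mp := @measurable_std_normal_pdf n.+1.
have mhp : measurable_fun setT (fun x => h x * (std_normal_pdf x)%:E).
  by apply: emeasurable_funM => //; exact/measurable_EFinP.
have hp0 x : 0 <= h x * (std_normal_pdf x)%:E.
  by rewrite mule_ge0// lee_fin std_normal_pdf_ge0.
rewrite integral_lebesgue_rVS// integral_gauss_rVS// integral_normal_prob//; last 2 first.
- exact: measurable_integral_gauss_rV.
- by move=> x; exact: integral_ge0.
apply: eq_integral => x _; rewrite -IH//; last exact: measurable_fun_rV_cons_fst.
rewrite -ge0_integralZr//; last 3 first.
- apply: emeasurable_funM; first exact: measurable_fun_rV_cons_fst.
  by apply/measurable_EFinP; exact: measurable_std_normal_pdf.
- by move=> v _; rewrite mule_ge0// lee_fin std_normal_pdf_ge0.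
- by rewrite lee_fin ltW// gauss_gt0.
apply: eq_integral => v _.
by rewrite std_normal_pdf_rV_cons EFinM muleA muleAC.
Qed.

End gaussian_measure_rV.

(** * Density of a contracted and shifted Gaussian, and its inverse square root *)

Section gaussian_tilt.
Context {R : realType}.
Local Notation N := (normal_prob (0 : R) 1).
Implicit Types c : R.

Definition tilt c n (v z : 'rV[R]_n) := \prod_(i < n) tilt1 c (v 0 i) (z 0 i).

Lemma tilt_rV_cons c n (x y : R) (v z : 'rV[R]_n) :
  tilt c (rV_cons (x, v)) (rV_cons (y, z)) = tilt1 c x y * tilt c v z.
Proof.
rewrite /tilt big_ord_recl !rV_cons0; congr *%R.
by apply: eq_bigr => i _; rewrite !rV_consS.
Qed.

Lemma measurable_tilt c n (v : 'rV[R]_n) : measurable_fun setT (tilt c v).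
Proof.
apply: measurable_prod => i _.
apply: (@measurableT_comp _ _ _ _ _ _ (tilt1 c (v 0 i))).
  by apply: continuous_measurable_fun; exact: continuous_tilt1.
exact: measurable_coord.
Qed.

Lemma tilt_ge0 c n (v z : 'rV[R]_n) : 0 < c -> 0 <= tilt c v z.
Proof.
move=> c0; apply: prodr_ge0 => i _.
by rewrite mulr_ge0 ?expR_ge0// invr_ge0 ltW.
Qed.

Lemma rV_consP n (v : 'rV[R]_n.+1) : exists x w, v = rV_cons (x, w).
Proof.
exists (v 0 ord0), (\row_i v 0 (lift ord0 i)).
apply/rowP => i; have [j ->|->] := unliftP ord0 i; last by rewrite rV_cons0.
by rewrite rV_consS mxE.
Qed.

Lemma measurable_affine_rV c n (v : 'rV[R]_n) :
  measurable_fun setT (fun z : 'rV[R]_n => c *: z - v).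
Proof.
apply: measurable_rV => i; under eq_fun do rewrite !mxE.
apply: measurable_funD => //; apply: measurable_funM => //.
exact: measurable_coord.
Qed.

Local Open Scope ereal_scope.

Lemma integral_tilt c n (v : 'rV[R]_n) (h : 'rV[R]_n -> \bar R) : (0 < c)%R ->
  measurable_fun setT h -> (forall z, 0 <= h z) ->
  \int[gauss_rV n]_z h (c *: z - v)%R = \int[gauss_rV n]_z (h z * (tilt c v z)%:E).
Proof.
move=> c0; elim: n v h => [|n IH] v h mh h0.
  rewrite !integral_dirac//; last 2 first.
  - by apply: emeasurable_funM => //; apply/measurable_EFinP; exact: measurable_tilt.
  - exact: measurableT_comp mh (measurable_affine_rV _ _).
  by rewrite !diracT !mul1e /tilt big_ord0 mule1; congr h; apply/rowP => -[].
have [x [w ->]] := rV_consP v.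
have mt : measurable_fun setT (fun z => (tilt c (rV_cons (x, w)) z)%:E).
  by apply/measurable_EFinP; exact: measurable_tilt.
rewrite !integral_gauss_rVS//; last 3 first.
- exact: emeasurable_funM.
- by move=> z; rewrite mule_ge0// lee_fin tilt_ge0.
- exact: measurableT_comp mh (measurable_affine_rV _ _).
(* The last [n] coordinates are tilted first, by induction; [H] is the resulting function of the
   first coordinate, to which the one-dimensional formula applies. *)
pose H y := \int[gauss_rV n]_z (h (rV_cons (y, z)) * (tilt c w z)%:E).
have H0 y : 0 <= H y.
  by apply: integral_ge0 => z _; rewrite mule_ge0// lee_fin tilt_ge0.
have mH : measurable_fun setT H.
  apply: (measurable_fun_fubini_tonelli_F
    (fun p : R * 'rV[R]_n => h (rV_cons p) * (tilt c w p.2)%:E)).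
  - apply: emeasurable_funM; first exact: measurable_comp_rV_cons.
    apply/measurable_EFinP; apply: measurableT_comp measurable_snd.
    exact: measurable_tilt.
  - by move=> p; rewrite mule_ge0// lee_fin tilt_ge0.
transitivity (\int[N]_y H (c * y - x)%R).
  apply: eq_integral => y _; rewrite /H -IH//; last exact: measurable_fun_rV_cons_fst.
  apply: eq_integral => z _; congr h; apply/rowP => i.
  have E (A B : 'rV[R]_n.+1) k : ((c *: A - B) 0 k = c * A 0 k - B 0 k)%R.
    by rewrite !mxE.
  rewrite E; have [j ->|->] := unliftP ord0 i; last by rewrite !rV_cons0.
  by rewrite !rV_consS !mxE.
rewrite integral_tilt1//; apply: eq_integral => y _; rewrite /H.
rewrite -ge0_integralZr//; last 3 first.
- apply: emeasurable_funM; first exact: measurable_fun_rV_cons_fst.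
  by apply/measurable_EFinP; exact: measurable_tilt.
- by move=> z _; rewrite mule_ge0// lee_fin tilt_ge0.
- by rewrite lee_fin mulr_ge0 ?expR_ge0// invr_ge0 ltW.
apply: eq_integral => z _.
by rewrite tilt_rV_cons [in RHS]EFinM [X in _ = _ * X]muleC muleA.
Qed.

Local Close Scope ereal_scope.

Lemma prod_expR_le n (a b : R) (v : 'rV[R]_n) (F : 'I_n -> R) :
  (forall i, 0 <= F i <= a * expR (b * v 0 i ^+ 2)) ->
  \prod_(i < n) F i <= a ^+ n * expR (b * eucl_norm v ^+ 2).
Proof.
move=> Fle; apply: (@le_trans _ _ (\prod_(i < n) (a * expR (b * v 0 i ^+ 2)))).
  by apply: ler_prod => i _; exact: Fle.
rewrite big_split/= prodr_const card_ord -expR_sum.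
by rewrite -mulr_sumr eucl_norm_sqr.
Qed.

Let s := (Num.sqrt 2)^-1 : R.

Let s_gt0 : 0 < s. Proof. by rewrite invr_gt0 sqrtr_gt0. Qed.

Let s2 : s ^+ 2 = 2^-1. Proof. by rewrite exprVn sqr_sqrtr. Qed.

(** For [s ^ 2 = 1 / 2] the exponent of a coordinate is [z ^ 2 / 2 - (z + v) ^ 2 = v ^ 2 - (z + 2 *
    v) ^ 2 / 2], at most [v ^ 2]; the prefactor is [s^-1 = sqrt 2]. *)
Lemma tilt_le n (v z : 'rV[R]_n) :
  tilt s v z <= Num.sqrt 2 ^+ n * expR (1 * eucl_norm v ^+ 2).
Proof.
have sV : 0 <= s^-1 by rewrite invr_ge0 ltW.
apply: prod_expR_le => i; rewrite /tilt1 mulr_ge0 ?expR_ge0//=.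
rewrite invrK ler_pM2l ?sqrtr_gt0// ler_expR exprMn sqr_sqrtr//.
have := sqr_ge0 (z 0 i + 2 * v 0 i); nra.
Qed.

(** The power -1/2 of [tilt1 s v x], written out. It grows like [exp (x ^ 2 / 4)], which is
    integrable under the Gaussian, whereas the plain inverse grows like [exp (x ^ 2 / 2)], which is
    not. *)
Definition tilt_invsqrt1 (v x : R) := Num.sqrt s * expR ((x + v) ^+ 2 / 2 - x ^+ 2 / 4).

Definition tilt_invsqrt n (v z : 'rV[R]_n) :=
  \prod_(i < n) tilt_invsqrt1 (v 0 i) (z 0 i).

Lemma tilt_invsqrt_gt0 n (v z : 'rV[R]_n) : 0 < tilt_invsqrt v z.
Proof. by apply: prodr_gt0 => i _; rewrite mulr_gt0 ?expR_gt0// sqrtr_gt0. Qed.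

Lemma tilt_gt0 c n (v z : 'rV[R]_n) : 0 < c -> 0 < tilt c v z.
Proof. by move=> c0; apply: prodr_gt0 => i _; rewrite mulr_gt0 ?expR_gt0// invr_gt0. Qed.

Lemma measurable_tilt_invsqrt n (v : 'rV[R]_n) :
  measurable_fun setT (tilt_invsqrt v).
Proof.
apply: measurable_prod => i _; apply: measurable_funM => //.
have mz := @measurable_coord R n i.
apply: measurableT_comp => //; apply: measurable_funB.
  by apply: measurable_funM => //; apply: measurable_funX; exact: measurable_funD.
by apply: measurable_funM => //; exact: measurable_funX.
Qed.

Lemma tilt_invsqrtK n (v z : 'rV[R]_n) : tilt s v z * tilt_invsqrt v z ^+ 2 = 1.
Proof.
rewrite -prodrXl -big_split/= big1// => i _.
rewrite /tilt1 /tilt_invsqrt1 [(Num.sqrt s * _) ^+ 2]exprMn sqr_sqrtr ?ltW//.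
rewrite mulrACA mulVf ?gt_eqF// mul1r [expR _ ^+ 2]expr2 -!expRD -[RHS]expR0; congr expR.
by rewrite [((_ + _) / s) ^+ 2]exprMn exprVn s2 invrK; field.
Qed.

Let integral_gauss_rV1 n : (\int[gauss_rV n]_z (1 : \bar R) = 1)%E.
Proof. rewrite integral_cst// mul1e; exact: probability_setT. Qed.

(** Up to constants this is the density of another Gaussian, of variance 2 and mean [2 * v]: the
    exponents [(z + v) ^ 2 / 2 - z ^ 2 / 4] and [z ^ 2 / 2 - (z - 2 * v) ^ 2 / 4] differ by
    [3 / 2 * v ^ 2]. That density integrates to 1; the factor [sqrt 2] undoes its normalization, and
    [Num.sqrt s] is bounded by 1. *)
Lemma integral_tilt_invsqrt n (v : 'rV[R]_n) :
  (\int[gauss_rV n]_z (tilt_invsqrt v z)%:E <=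
   (Num.sqrt 2 ^+ n * expR (3 / 2 * eucl_norm v ^+ 2))%:E)%E.
Proof.
pose u : 'rV[R]_n := - 2 *: v.
pose a := Num.sqrt 2 ^+ n * expR (3 / 2 * eucl_norm v ^+ 2).
have r2 : 0 < Num.sqrt 2 :> R by rewrite sqrtr_gt0.
have a0 : 0 <= a by rewrite mulr_ge0 ?expR_ge0// exprn_ge0// ltW.
have tle z : tilt_invsqrt v z <= a * tilt (Num.sqrt 2) u z.
  have aE : a = \prod_(i < n) (Num.sqrt 2 * expR (3 / 2 * v 0 i ^+ 2)).
    by rewrite big_split/= prodr_const card_ord -expR_sum -mulr_sumr -eucl_norm_sqr.
  rewrite aE -big_split/=; apply: ler_prod => i _.
  rewrite /tilt_invsqrt1 /tilt1 mulr_ge0 ?sqrtr_ge0 ?expR_ge0//=.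
  rewrite mulrACA divff ?gt_eqF// mul1r -expRD.
  have s1 : Num.sqrt s <= 1.
    rewrite -[leRHS]sqrtr1 ler_wsqrtr// -(@ler_pXn2r _ 2)// ?nnegrE ?(ltW s_gt0)//.
    by rewrite s2 expr1n; lra.
  rewrite -[leRHS]mul1r; apply: ler_pM => //; rewrite ?sqrtr_ge0 ?expR_ge0//.
  rewrite ler_expR exprMn exprVn sqr_sqrtr// !mxE; lra.
have mt : measurable_fun setT (fun z => (tilt (Num.sqrt 2) u z)%:E).
  by apply/measurable_EFinP; exact: measurable_tilt.
apply: (@le_trans _ _ (\int[gauss_rV n]_z (a%:E * (1 * (tilt (Num.sqrt 2) u z)%:E)))%E).
  apply: ge0_le_integral => //=.
  - by move=> z _; rewrite lee_fin ltW// tilt_invsqrt_gt0.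
  - by apply/measurable_EFinP; exact: measurable_tilt_invsqrt.
  - by apply: measurable_funeM; under eq_fun do rewrite mul1e.
  - by move=> z _; rewrite mul1e -EFinM lee_fin.
rewrite ge0_integralZl//; last 2 first.
- by under eq_fun do rewrite mul1e.
- by move=> z _; rewrite mul1e lee_fin tilt_ge0.
rewrite -(@integral_tilt _ _ _ (fun=> 1%E))//.
by rewrite integral_gauss_rV1 mule1.
Qed.

Lemma integral_tilt1_cst n (v : 'rV[R]_n) :
  (\int[gauss_rV n]_z (tilt s v z)%:E = 1)%E.
Proof.
under eq_integral do rewrite -[(tilt _ _ _)%:E]mul1e.
by rewrite -(@integral_tilt _ _ _ (fun=> 1%E)).
Qed.

End gaussian_tilt.

(** * Almost everywhere finite integrals and tensorization of the entropy bound *)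

Section nonnegative_integrals.
Local Open Scope ereal_scope.
Context d (T : measurableType d) (R : realType) (P : probability T R).

Lemma ge0_ae_le_integral (Q : T -> Prop) (f g : T -> \bar R) :
  measurable_fun setT f -> measurable_fun setT g ->
  (forall x, 0 <= f x) -> (forall x, 0 <= g x) ->
  {ae P, forall x, Q x} -> (forall x, Q x -> f x <= g x) ->
  \int[P]_x f x <= \int[P]_x g x.
Proof.
move=> mf mg f0 g0 aeQ fg.
have mfg : measurable_fun setT (fun x => mine (f x) (g x)) by exact: measurable_mine.
rewrite (@ge0_ae_eq_integral _ _ _ _ setT f (fun x => mine (f x) (g x)))//.
- apply: ge0_le_integral => //.
  + by move=> x _; rewrite le_min f0 g0.
  + by move=> x _; rewrite ge_min lexx orbT.
- by move=> x _; rewrite le_min f0 g0.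
- by apply: filterS aeQ => x /fg fgx _; rewrite (min_idPl fgx).
Qed.

Lemma integral_probability_gt0 (f : T -> \bar R) :
  measurable_fun setT f -> (forall x, 0 < f x) -> 0 < \int[P]_x f x.
Proof.
move=> mf f0; rewrite lt_def integral_ge0 ?andbT; last by move=> x _; exact: ltW.
apply/eqP => i0.
have /(ae_eq_integral_abs _ measurableT mf)[N [mN N0 sN]] : \int[P]_x `|f x| = 0.
  by rewrite -i0; apply: eq_integral => x _; rewrite gee0_abs// ltW.
have : P setT <= P N.
  apply: le_measure; rewrite ?inE// => x _; apply: sN => /= /(_ I) fx.
  by have := f0 x; rewrite fx ltxx.
by rewrite N0 probability_setT leNgt lte01.
Qed.

(** The default value is 1 rather than 0, so that a positive function stays positive and can serve
    as an argument of [kl]. *)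
Definition finite_version (f : T -> \bar R) x :=
  if f x \is a fin_num then fine (f x) else 1%R.

Lemma measurable_finite_version f :
  measurable_fun setT f -> measurable_fun setT (finite_version f).
Proof.
move=> mf; apply: measurable_fun_ifT => //.
- by apply: (measurable_fun_bool true); exact: emeasurable_fin_num.
- exact: measurableT_comp.
Qed.

Lemma finite_version_gt0 f x : 0 < f x -> (0 < finite_version f x)%R.
Proof.
by move=> f0; rewrite /finite_version; case: ifPn => // ff; rewrite fine_gt0// f0 ltey_eq ff.
Qed.

Lemma finite_versionE f x : f x \is a fin_num -> (finite_version f x)%:E = f x.
Proof. by move=> ff; rewrite /finite_version ff fineK. Qed.

Lemma integral_finite_version f : measurable_fun setT f -> (forall x, 0 < f x) ->
  \int[P]_x f x < +oo ->
  {ae P, forall x, f x \is a fin_num} /\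
  \int[P]_x (finite_version f x)%:E = \int[P]_x f x.
Proof.
move=> mf f0 foo.
have fint : P.-integrable setT f.
  apply/integrableP; split => //.
  by under eq_integral do rewrite gee0_abs ?ltW//.
have fin : {ae P, forall x, f x \is a fin_num}.
  by have := integrable_ae measurableT fint; apply: filterS => x; exact.
split => //; apply: ge0_ae_eq_integral => //.
- by apply/measurable_EFinP; exact: measurable_finite_version.
- by move=> x _; rewrite lee_fin ltW// finite_version_gt0.
- by move=> x _; exact: ltW.
- by apply: filterS fin => x fx _; exact: finite_versionE.
Qed.

End nonnegative_integrals.

Section tensorization.
Local Open Scope ereal_scope.
Context d1 d2 (T1 : measurableType d1) (T2 : measurableType d2) (R : realType).
Context (P1 : probability T1 R) (P2 : probability T2 R).
Variables (u : T1 * T2 -> R) (G1 G2 : T1 * T2 -> \bar R) (m : R).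
Hypotheses (mu : measurable_fun setT u) (u_gt0 : forall p, (0 < u p)%R).
Hypotheses (mG1 : measurable_fun setT G1) (G1_ge0 : forall p, 0 <= G1 p).
Hypotheses (mG2 : measurable_fun setT G2) (G2_ge0 : forall p, 0 <= G2 p).
Hypothesis kl_le1 : forall y c, (0 < c)%R -> \int[P1]_x (u (x, y))%:E = c%:E ->
  \int[P1]_x (kl (u (x, y)) c)%:E <= \int[P1]_x G1 (x, y).
Hypothesis kl_le2 : forall x c, (0 < c)%R -> \int[P2]_y (u (x, y))%:E = c%:E ->
  \int[P2]_y (kl (u (x, y)) c)%:E <= \int[P2]_y G2 (x, y).
Hypothesis um : \int[P1]_x \int[P2]_y (u (x, y))%:E = m%:E.

Let F2 x := \int[P2]_y (u (x, y))%:E.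
Let F1 y := \int[P1]_x (u (x, y))%:E.
Let b := finite_version F2.
Let a := finite_version F1.

Let mEu : measurable_fun setT (fun p => (u p)%:E).
Proof. exact/measurable_EFinP. Qed.

Let Eu_ge0 p : 0 <= (u p)%:E. Proof. by rewrite lee_fin ltW. Qed.

Let mu1 x : measurable_fun setT (fun y => u (x, y)).
Proof. by apply: measurableT_comp mu _; exact: measurable_pair1. Qed.

Let mu2 y : measurable_fun setT (fun x => u (x, y)).
Proof. by apply: measurableT_comp mu _; exact: measurable_pair2. Qed.

Let mF2 : measurable_fun setT F2.
Proof. exact: (measurable_fun_fubini_tonelli_F (fun p => (u p)%:E)). Qed.

Let mF1 : measurable_fun setT F1.
Proof. exact: (measurable_fun_fubini_tonelli_G (fun p => (u p)%:E)). Qed.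

Let F2_gt0 x : 0 < F2 x.
Proof.
by apply: integral_probability_gt0 => [|y]; [exact/measurable_EFinP|rewrite lte_fin].
Qed.

Let F1_gt0 y : 0 < F1 y.
Proof.
by apply: integral_probability_gt0 => [|x]; [exact/measurable_EFinP|rewrite lte_fin].
Qed.

Let b_gt0 x : (0 < b x)%R. Proof. exact: finite_version_gt0. Qed.
Let a_gt0 y : (0 < a y)%R. Proof. exact: finite_version_gt0. Qed.
Let mb : measurable_fun setT b. Proof. exact: measurable_finite_version. Qed.
Let ma : measurable_fun setT a. Proof. exact: measurable_finite_version. Qed.

Let m_gt0 : (0 < m)%R.
Proof. by rewrite -lte_fin -um; exact: integral_probability_gt0. Qed.

Let F1E : \int[P2]_y F1 y = m%:E.
Proof. by rewrite -um (fubini_tonelli (fun p => (u p)%:E)). Qed.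

Let kla p := (kl (u p) (a p.2))%:E.

Let mkla : measurable_fun setT kla.
Proof.
apply/measurable_EFinP/measurable_kl => //.
exact: measurableT_comp ma measurable_snd.
Qed.

Let kla_ge0 p : 0 <= kla p.
Proof. by rewrite lee_fin kl_ge0// ltW. Qed.

Let klm p := (kl (u p) m)%:E.

Let mklm : measurable_fun setT klm.
Proof. exact/measurable_EFinP/measurable_kl. Qed.

Let klm_ge0 p : 0 <= klm p.
Proof. by rewrite lee_fin kl_ge0// ltW. Qed.

Let kl_b_ge0 x : 0 <= (kl (b x) m)%:E.
Proof. by rewrite lee_fin kl_ge0// ltW. Qed.

Let mkl_b : measurable_fun setT (fun x => (kl (b x) m)%:E).
Proof. exact/measurable_EFinP/measurable_kl. Qed.

Let step1 x : F2 x \is a fin_num ->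
  \int[P2]_y klm (x, y) <= \int[P2]_y G2 (x, y) + (kl (b x) m)%:E.
Proof.
move=> F2fin; have bE : \int[P2]_y (u (x, y))%:E = (b x)%:E by rewrite finite_versionE.
have klb := kl_le2 (b_gt0 x) bE.
have [bfin|] := ltP (\int[P2]_y (kl (u (x, y)) (b x))%:E) +oo; last first.
  rewrite leye_eq => /eqP boo; move: klb; rewrite boo leye_eq => /eqP ->.
  by rewrite addye ?leey.
have [_ ->] := kl_compensation (mu1 x) (fun y => u_gt0 (x, y)) (b_gt0 x) m_gt0 bE bfin.
by rewrite ln_div ?posrE// -/(kl (b x) m) leeD2r.
Qed.

Let step2 x : F2 x \is a fin_num -> (kl (b x) m)%:E <= \int[P2]_y kla (x, y).
Proof.
move=> F2fin; apply: kl_jensen => //.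
- by move=> y; rewrite ltW.
- by rewrite finite_versionE.
- by rewrite (integral_finite_version mF1 F1_gt0 _).2 F1E ?ltry.
Qed.

Let step3 y : F1 y \is a fin_num ->
  \int[P1]_x kla (x, y) <= \int[P1]_x G1 (x, y).
Proof.
move=> F1fin; have aE : \int[P1]_x (u (x, y))%:E = (a y)%:E by rewrite finite_versionE.
exact: (kl_le1 (a_gt0 y) aE).
Qed.

Let F2fin : {ae P1, forall x, F2 x \is a fin_num}.
Proof. by apply: (integral_finite_version mF2 F2_gt0 _).1; rewrite um ltry. Qed.

Let F1fin : {ae P2, forall y, F1 y \is a fin_num}.
Proof. by apply: (integral_finite_version mF1 F1_gt0 _).1; rewrite F1E ltry. Qed.

(** For fixed [x], the chain rule around the partial mean [b x] isolates [kl (b x) m]. Joint Jensen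
    bounds this by the [P2]-mean of [kl (u (x, y)) (a y)], because [b x] and [m] are the [P2]-means
    of [u (x, _)] and [a]. After Tonelli, [kl_le1] applies for fixed [y]. In this way the partial
    mean [b] is never differentiated. *)
Lemma kl_tensorization :
  \int[P1]_x \int[P2]_y (kl (u (x, y)) m)%:E <=
  \int[P1]_x \int[P2]_y G1 (x, y) + \int[P1]_x \int[P2]_y G2 (x, y).
Proof.
have mIG2 : measurable_fun setT (fun x => \int[P2]_y G2 (x, y)).
  exact: measurable_fun_fubini_tonelli_F.
have IG2 x : 0 <= \int[P2]_y G2 (x, y) by exact: integral_ge0.
have klb_le : \int[P1]_x (kl (b x) m)%:E <= \int[P1]_x \int[P2]_y G1 (x, y).
  apply: (@le_trans _ _ (\int[P1]_x \int[P2]_y kla (x, y))).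
    apply: (ge0_ae_le_integral _ _ _ _ F2fin step2) => //.
    - exact: (measurable_fun_fubini_tonelli_F kla).
    - by move=> x; exact: integral_ge0.
  rewrite (fubini_tonelli kla)// (fubini_tonelli G1)//.
  apply: (ge0_ae_le_integral _ _ _ _ F1fin step3) => //.
  - exact: (measurable_fun_fubini_tonelli_G kla).
  - exact: (measurable_fun_fubini_tonelli_G G1).
  - by move=> y; exact: integral_ge0.
  - by move=> y; exact: integral_ge0.
rewrite addeC; apply: le_trans (leeD2l _ klb_le).
rewrite -ge0_integralD//; apply: (ge0_ae_le_integral _ _ _ _ F2fin step1) => //.
- exact: (measurable_fun_fubini_tonelli_F klm).
- exact: emeasurable_funD.
- by move=> x; apply: integral_ge0 => y _; exact: klm_ge0.
- by move=> x; exact: adde_ge0.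
Qed.

End tensorization.

(** * Replacing the mean by the mean under another density *)

Section recentering.
Local Open Scope ereal_scope.
Context d (T : measurableType d) (R : realType) (P : probability T R).

(** With [E] the integral of [kl u a], the left side is [E + kl a b]. If [a <= 4 * b], exchanging
    the arguments gives [kl a b <= 9 * K * E]. Otherwise [a <= 4 * K * E] and [a * ln (a / b) <= 2 *
    E + 2 * a * (C - 1)], so that [kl a b <= (2 + 8 * C * K) * E]. The stated constant covers both
    cases. *)
Lemma kl_recentering (u p r : T -> R) (a b K C : R) :
  measurable_fun setT u -> measurable_fun setT p -> measurable_fun setT r ->
  (forall x, 0 < u x)%R -> (forall x, 0 < p x)%R -> (forall x, 0 < r x)%R ->
  (forall x, p x * r x ^+ 2 = 1)%R -> (forall x, p x <= K)%R ->
  (0 <= C)%R -> (0 < a)%R -> (0 < b)%R ->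
  \int[P]_x (p x)%:E = 1 -> \int[P]_x (r x)%:E <= C%:E ->
  \int[P]_x (u x)%:E = a%:E -> \int[P]_x (u x * p x)%:E = b%:E ->
  \int[P]_x (kl (u x) b)%:E <=
    (3 + 9 * K + 8 * C * K)%:E * \int[P]_x (kl (u x) a)%:E.
Proof.
move=> mu mp mr u0 p0 r0 pr pK C0 a0 b0 p1 rC ua ub.
have K0 : (0 < K)%R by apply: lt_le_trans (p0 point) (pK _).
have k0 : (0 < 3 + 9 * K + 8 * C * K)%R by nra.
have klu0 x : (0 <= kl (u x) a)%R by apply: kl_ge0 => //; exact: ltW.
have E0 : 0 <= \int[P]_x (kl (u x) a)%:E by apply: integral_ge0 => x _; rewrite lee_fin.
have mkl : measurable_fun setT (fun x => kl (u x) a) by exact: measurable_kl.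
have [Eoo|] := ltP (\int[P]_x (kl (u x) a)%:E) +oo; last first.
  by rewrite leye_eq => /eqP ->; rewrite gt0_muley ?lte_fin// leey.
have [E EE] : exists E, \int[P]_x (kl (u x) a)%:E = E%:E.
  by exists (fine (\int[P]_x (kl (u x) a)%:E)); rewrite fineK// ge0_fin_numE.
have [_ ->] := kl_compensation mu u0 a0 b0 ua Eoo.
rewrite EE -EFinD -EFinM lee_fin -/(kl a b).
move: E0; rewrite EE lee_fin => E0.
have swap : (kl b a <= K * E)%R.
  rewrite -lee_fin.
  have apa : \int[P]_x (a * p x)%:E = a%:E.
    under eq_integral do rewrite EFinM.
    rewrite ge0_integralZl//; first by rewrite p1 mule1.
    - exact/measurable_EFinP.
    - by move=> x _; rewrite lee_fin ltW.
    - by rewrite lee_fin ltW.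
  (* [b] and [a] are the integrals of [u * p] and [a * p]; by homogeneity the Jensen integrand is
     [p * kl u a], at most [K * kl u a]. *)
  have := kl_jensen (mu := P) (measurable_funM mu mp)
     (measurable_funM (measurable_cst a) mp)
     (fun x => ltW (mulr_gt0 (u0 x) (p0 x))) (fun x => mulr_gt0 a0 (p0 x))
     b0 a0 ub apa.
  move=> /le_trans; apply.
  rewrite EFinM -EE -ge0_integralZl//; last 3 first.
  - exact/measurable_EFinP.
  - by move=> x _; rewrite lee_fin.
  - by rewrite lee_fin ltW.
  apply: ge0_le_integral => //=.
  - move=> x _; rewrite lee_fin kl_ge0 ?mulr_gt0 ?mulr_ge0// ltW//.
  - apply/measurable_EFinP/measurable_kl; first exact: measurable_funM.
    exact: measurable_funM.
  - by apply: measurable_funeM; exact/measurable_EFinP.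
  - by move=> x _; rewrite kl_homogeneous// -EFinM lee_fin ler_wpM2r.
have [ab|ab] := leP a (4 * b)%R.
  have := kl_le_kl_swap a0 b0 ab; rewrite {1}/kl ln_div ?posrE//.
  have := mulr_ge0 C0 (mulr_ge0 (ltW K0) E0); rewrite !mulrDl; lra.
have a4 := le_4kl a0 b0 ab.
(* [ln (a / b) <= - ln p + (p * a / b - 1)], the last term has [u]-integral 0,
   and [- ln p = 2 * ln r] is handled by [kl_young]. *)
suff aln : (a * ln (a / b) <= 2 * E + 2 * a * (C - 1))%R.
  have aE : (a <= 4 * (K * E))%R by lra.
  have := ler_wpM2r C0 aE; have := mulr_ge0 (ltW K0) E0.
  by rewrite !mulrDl; lra.
have rint : P.-integrable setT (EFin \o r).
  by apply: ge0_integrable => [//|x|]; [exact: ltW|exact: le_lt_trans rC (ltry _)].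
have [c cE] : exists c, \int[P]_x (r x)%:E = c%:E.
  by exists (fine (\int[P]_x (r x)%:E)); rewrite fineK//; exact: integrable_fin_num.
have cC : (c <= C)%R by move: rC; rewrite cE.
have uint : P.-integrable setT (EFin \o u).
  by apply: ge0_integrable => [//|x|]; [exact: ltW|rewrite ua ltry].
have upint : P.-integrable setT (EFin \o (fun x => u x * p x)%R).
  apply: ge0_integrable => [|x|]; first exact: measurable_funM.
    by rewrite mulr_ge0 ?ltW.
  by rewrite ub ltry.
have i1 : P.-integrable setT (EFin \o cst (1:R)%R).
  by apply: finite_measure_integrable_cst.
have c1 : \int[P]_x (cst (1:R)%R x)%:E = (1:R)%R%:E.
  by rewrite /= integral_cst// mul1e; exact: probability_setT.
have [h1i h1E] := integral_affine2 (ln (a / b) + 1) (- (a / b)) uint upint ua ub.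
have [h2i h2E] := integral_affine2 (- (2 * a)) (2 * a) rint i1 cE c1.
have [h3i h3E] := integral_affine2 1 1 h1i h2i h1E h2E.
have : ((a * (ln (a / b) + 1) + b * - (a / b)) * 1 +
    (c * - (2 * a) + 1 * (2 * a)) * 1 <= 2 * E)%R.
  rewrite -lee_fin -h3E EFinM -EE -ge0_integralZl//; last 2 first.
  - exact/measurable_EFinP.
  - by move=> x _; rewrite lee_fin.
  apply: integrable_le_integral => //.
  - exact: measurable_funM.
  - by move=> x; rewrite mulr_ge0.
  move=> x /=.
  have y := kl_young (u0 x) a0 (r0 x).
  have pab : (0 < p x * (a / b))%R by rewrite mulr_gt0// divr_gt0.
  have := ln_le_subr1 pab; rewrite lnM ?posrE ?divr_gt0//.
  have -> : ln (p x) = (- (2 * ln (r x)))%R.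
    have := congr1 (@ln R) (pr x); rewrite ln1 lnM ?posrE ?exprn_gt0// lnXn//.
    by rewrite mulr2n => l; lra.
  move=> /(ler_wpM2l (ltW (u0 x))); nra.
have -> : (b * - (a / b) = - a)%R by field; rewrite gt_eqF.
nra.
Qed.
End recentering.

(** * The Gaussian log-Sobolev inequality in dimension [n], centred and shifted *)

Section gaussian_log_sobolev.
Context {R : realType}.
Local Notation N := (normal_prob (0 : R) 1).
Local Notation e i := (delta_mx 0 i).

Lemma rV_cons_add_delta0 n (x r : R) (v : 'rV[R]_n) :
  rV_cons (x, v) + r *: e ord0 = rV_cons (x + r, v).
Proof.
have E (A B : 'rV[R]_n.+1) k : (A + r *: B) 0 k = A 0 k + r * B 0 k.
  by rewrite !mxE.
apply/rowP => i; rewrite E [delta_mx _ _ _ _]mxE eqxx/=.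
have [j ->|->] := unliftP ord0 i; last by rewrite !rV_cons0 eqxx mulr1.
by rewrite !rV_consS eq_sym (negbTE (neq_lift _ _)) mulr0 addr0.
Qed.

Lemma rV_cons_add_deltaS n (x r : R) (v : 'rV[R]_n) i :
  rV_cons (x, v) + r *: e (lift ord0 i) = rV_cons (x, v + r *: e i).
Proof.
have E (A B : 'rV[R]_n.+1) k : (A + r *: B) 0 k = A 0 k + r * B 0 k.
  by rewrite !mxE.
apply/rowP => k; rewrite E [delta_mx _ _ _ _]mxE eqxx/=.
have [j ->|->] := unliftP ord0 k.
  by rewrite !rV_consS !mxE eqxx/= (inj_eq lift_inj).
by rewrite !rV_cons0 (negbTE (neq_lift _ _)) mulr0 addr0.
Qed.

(** Regularity is asked only along coordinate lines, a form that restricts to slices and so survives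
    the induction. Each step tensorizes the one-dimensional inequality in the first coordinate with
    the induction hypothesis in the others. *)
Lemma gaussian_log_sobolev n (f : 'rV[R]_n -> R) (G : 'I_n -> 'rV[R]_n -> R) m :
  measurable_fun setT f -> (forall i, measurable_fun setT (G i)) ->
  (forall v, 0 < f v) ->
  (forall i v (r : R), is_derive r 1 (fun r => f (v + r *: e i)) (G i (v + r *: e i))) ->
  (forall i v, continuous (fun r : R => G i (v + r *: e i))) ->
  (\int[gauss_rV n]_v (f v ^+ 2)%:E = m%:E)%E ->
  (\int[gauss_rV n]_v (kl (f v ^+ 2) m)%:E <=
   \int[gauss_rV n]_v (2 * \sum_(i < n) G i v ^+ 2)%:E)%E.
Proof.
elim: n f G m => [|n IH] f G m mf mG f0 df cG fm.
  have fE : f 0 ^+ 2 = m.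
    move: fm; rewrite integral_dirac//; last first.
      by apply/measurable_EFinP; exact: measurable_funX.
    by rewrite diracT mul1e => -[].
  rewrite integral_dirac//; last first.
    by apply/measurable_EFinP/measurable_kl => //; exact: measurable_funX.
  rewrite fE kl_diag mule0; apply: integral_ge0 => v _.
  by rewrite lee_fin mulr_ge0// sumr_ge0// => i _; exact: sqr_ge0.
have f2_gt0 v : 0 < f v ^+ 2 by rewrite exprn_gt0.
have mf2 : measurable_fun setT (fun v => f v ^+ 2) by exact: measurable_funX.
have mEf2 : measurable_fun setT (fun v => (f v ^+ 2)%:E).
  exact/measurable_EFinP.
have mG0 : measurable_fun setT (fun v => (2 * G ord0 v ^+ 2)%:E).
  by apply/measurable_EFinP; apply: measurable_funM => //; exact: measurable_funX.
have mGS : measurable_fun setT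
    (fun v => (2 * \sum_(i < n) G (lift ord0 i) v ^+ 2)%:E).
  apply/measurable_EFinP; apply: measurable_funM => //.
  by apply: measurable_sum => i; exact: measurable_funX.
have G0_ge0 v : (0 <= (2 * G ord0 v ^+ 2)%:E)%E.
  by rewrite lee_fin mulr_ge0 ?sqr_ge0.
have GS_ge0 v : (0 <= (2 * \sum_(i < n) G (lift ord0 i) v ^+ 2)%:E)%E.
  by rewrite lee_fin mulr_ge0// sumr_ge0// => i _; exact: sqr_ge0.
have m0 : 0 < m by rewrite -lte_fin -fm; apply: integral_probability_gt0.
have sumE v : (2 * \sum_(i < n.+1) G i v ^+ 2)%:E =
    ((2 * G ord0 v ^+ 2)%:E + (2 * \sum_(i < n) G (lift ord0 i) v ^+ 2)%:E)%E.
  by rewrite big_ord_recl mulrDr EFinD.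
under [leRHS]eq_integral do rewrite sumE.
rewrite ge0_integralD// !integral_gauss_rVS//; last 2 first.
- exact/measurable_EFinP/measurable_kl.
- by move=> v; rewrite lee_fin kl_ge0// ltW.
apply: (@kl_tensorization _ _ _ _ R N (gauss_rV n) (fun p => f (rV_cons p) ^+ 2)
  (fun p => (2 * G ord0 (rV_cons p) ^+ 2)%:E)
  (fun p => (2 * \sum_(i < n) G (lift ord0 i) (rV_cons p) ^+ 2)%:E)).
- exact: measurableT_comp mf2 (measurable_rV_cons (n:=n)).
- by [].
- exact: measurable_comp_rV_cons mG0.
- by [].
- exact: measurable_comp_rV_cons mGS.
- by [].
- move=> v c c0 fc.
  have lineE x : rV_cons (0, v) + x *: e ord0 = rV_cons (x, v).
    by rewrite rV_cons_add_delta0 add0r.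
  apply: (@gaussian_log_sobolev_1d R (fun x => f (rV_cons (x, v)))
    (fun x => G ord0 (rV_cons (x, v)))) => //.
  + move=> x; rewrite -lineE.
    by under eq_fun do rewrite -lineE; exact: df.
  + by under eq_fun do rewrite -lineE; exact: cG.
- move=> x c c0 fc.
  apply: (IH (fun v => f (rV_cons (x, v)))
    (fun i v => G (lift ord0 i) (rV_cons (x, v)))) => //.
  + exact: measurableT_comp mf
      (measurableT_comp (measurable_rV_cons (n:=n)) (measurable_pair1 x)).
  + move=> i.
    exact: measurableT_comp (mG _)
      (measurableT_comp (measurable_rV_cons (n:=n)) (measurable_pair1 x)).
  + move=> i v r; rewrite -rV_cons_add_deltaS.
    by under eq_fun do rewrite -rV_cons_add_deltaS; exact: df.
  + by move=> i v; under eq_fun do rewrite -rV_cons_add_deltaS; exact: cG.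
- by rewrite -fm integral_gauss_rVS// => v; rewrite lee_fin ltW.
Qed.

End gaussian_log_sobolev.

Section gaussian_shift.
Context {R : realType} (n : nat).
Implicit Types (f : 'rV[R]_n -> R) (y z v : 'rV[R]_n).
Local Notation e i := (delta_mx 0 i).
Local Notation c := ((Num.sqrt 2)^-1 : R).

Lemma is_derive_line f y v (r : R) : differentiable f (y + r *: v) ->
  is_derive r 1 (fun r => f (y + r *: v)) ('D_v f (y + r *: v)).
Proof.
move=> df; have dfv : derivable f (y + r *: v) v by exact: diff_derivable.
have E : (fun h : R => h^-1 *:
     (((fun r => f (y + r *: v)) \o shift r) (h *: 1) - f (y + r *: v)))
   = (fun h : R => h^-1 *: ((f \o shift (y + r *: v)) (h *: v) - f (y + r *: v))).
  apply/funext => h /=; congr (_ *: (f _ - _)).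
  by rewrite [h *: 1]mulr1 scalerDl addrCA addrA.
by split; [rewrite /derivable E|rewrite /derive E].
Qed.

Lemma derive_scale f y v (s : R) : differentiable f y ->
  'D_(s *: v) f y = s * 'D_v f y.
Proof. by move=> df; rewrite !deriveE// linearZ. Qed.

Lemma shift_line y v z (s r : R) :
  y + s *: (z + r *: v) = (y + s *: z) + r *: (s *: v).
Proof. by rewrite scalerDr addrA scalerA mulrC -scalerA. Qed.

Lemma continuous_line y v : continuous (fun r : R => y + r *: v).
Proof.
move=> r; apply: cvgD; first exact: cvg_cst.
exact: scalel_continuous.
Qed.

Lemma measurable_shift y (s : R) : measurable_fun setT (fun z => y + s *: z).
Proof.
by have := measurable_affine_rV s (- y); under eq_fun do rewrite opprK addrC.
Qed.

Lemma measurable_shift2 (s : R) :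
  measurable_fun setT (fun p : 'rV[R]_n * 'rV[R]_n => p.1 + s *: p.2).
Proof.
apply: measurable_rV => i; under eq_fun do rewrite !mxE.
apply: measurable_funD.
  exact: measurableT_comp (measurable_coord i) measurable_fst.
apply: measurable_funM => //.
exact: measurableT_comp (measurable_coord i) measurable_snd.
Qed.

Lemma measurable_integral_shift (s : R) (h : 'rV[R]_n -> \bar R) :
  measurable_fun setT h -> (forall x, 0 <= h x)%E ->
  measurable_fun setT (fun y : 'rV[R]_n => \int[gauss_rV n]_z h (y + s *: z)%R)%E.
Proof.
move=> mh h0; apply: (measurable_fun_fubini_tonelli_F
  (fun p : 'rV[R]_n * 'rV[R]_n => h (p.1 + s *: p.2)%R)) => //.
exact: measurableT_comp mh (measurable_shift2 s).
Qed.

Lemma measurable_gradient f i : continuously_differentiable f ->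
  measurable_fun setT (fun x => gradient f x 0 i).
Proof.
move=> [_ cg]; apply: continuous_rV_measurable_fun => x.
apply: (@continuous_comp _ _ _ (gradient f) (fun w : 'rV[R]_n => w 0 i)).
  exact: cg.
exact: coord_continuous.
Qed.

Lemma continuously_differentiable_measurable f :
  continuously_differentiable f -> measurable_fun setT f.
Proof.
by move=> [df _]; apply: continuous_rV_measurable_fun => x;
  exact: differentiable_continuous.
Qed.

Local Open Scope ereal_scope.

Lemma log_sobolev_shift f y (s m : R) : continuously_differentiable f ->
  (forall x, 0 < f x)%R ->
  \int[gauss_rV n]_z (f (y + s *: z) ^+ 2)%:E = m%:E ->
  \int[gauss_rV n]_z (kl (f (y + s *: z) ^+ 2) m)%:E <=
  (2 * s ^+ 2)%:E * \int[gauss_rV n]_z (eucl_norm (gradient f (y + s *: z)) ^+ 2)%:E.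
Proof.
move=> cdf f0 fm; have [df cg] := cdf.
have mf := continuously_differentiable_measurable cdf.
pose G i z := (s * gradient f (y + s *: z) 0 i)%R.
rewrite -ge0_integralZl//; last 3 first.
- apply/measurable_EFinP.
  apply: measurableT_comp (@measurable_eucl_norm_sqr R n) _.
  apply: measurable_rV => i.
  exact: measurableT_comp (measurable_gradient i cdf) (measurable_shift _ _).
- by move=> z _; rewrite lee_fin sqr_ge0.
- by rewrite lee_fin mulr_ge0 ?sqr_ge0.
have GE z : (2 * s ^+ 2)%:E * (eucl_norm (gradient f (y + s *: z)) ^+ 2)%:E =
    (2 * \sum_(i < n) G i z ^+ 2)%:E.
  rewrite -EFinM eucl_norm_sqr -mulrA mulr_sumr; congr (2 * _)%:E.
  by apply: eq_bigr => i _; rewrite -exprMn.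
under [leRHS]eq_integral do rewrite GE.
apply: (@gaussian_log_sobolev R n (fun z => f (y + s *: z)%R) G) => //.
- exact: measurableT_comp mf (measurable_shift _ _).
- move=> i; apply: measurable_funM => //.
  exact: measurableT_comp (measurable_gradient i cdf) (measurable_shift _ _).
- move=> i v r; under eq_fun do rewrite shift_line.
  rewrite /G shift_line mxE -derive_scale//.
  exact: is_derive_line.
- move=> i v; have cl : continuous
      (fun r : R => gradient f ((y + s *: v) + r *: (s *: e i)) 0 i)%R.
    move=> r; apply: (@continuous_comp _ _ _
      (fun r : R => (y + s *: v) + r *: (s *: e i))%R
      (fun x => gradient f x 0 i)%R).
      exact: continuous_line.
    apply: (@continuous_comp _ _ _ (gradient f) (fun w : 'rV[R]_n => w 0 i)%R).
      exact: cg.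
    exact: coord_continuous.
  under eq_fun do rewrite /G shift_line.
  by move=> r; apply: cvgM; [exact: cvg_cst|exact: cl].
Qed.

Let c_gt0 : (0 < c)%R. Proof. by rewrite invr_gt0 sqrtr_gt0. Qed.

(** Substituting [c *: z - s^-1 *: y] for [z] turns [y + s *: z] into [s *: (c *: z)], from which
    [y] has disappeared: the tilt is the density of N(0, s^2 / 2) relative to the law of
    [y + s Z]. *)
Lemma integral_shift_tilt (h : 'rV[R]_n -> \bar R) y (s : R) : (0 < s)%R ->
  measurable_fun setT h -> (forall x, 0 <= h x) ->
  \int[gauss_rV n]_z h (s *: (c *: z))%R =
  \int[gauss_rV n]_z (h (y + s *: z)%R * (tilt c (s^-1 *: y) z)%:E).
Proof.
move=> s0 mh h0.
rewrite -(integral_tilt (s^-1 *: y)%R c_gt0 (measurableT_comp mh (measurable_shift y s)))//=.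
apply: eq_integral => z _; congr (h _).
by rewrite scalerBr [(s *: (s^-1 *: y))%R]scalerA mulfV ?gt_eqF// scale1r addrCA subrr addr0.
Qed.

(* [K] bounds the density of N(0, s^2 / 2) with respect to the law of [y + s Z],
   and [C] the integral of the inverse square root of this density. *)
Lemma kl_shift_le f y (s x q K C : R) : (0 < s)%R ->
  continuously_differentiable f -> (forall x, 0 < f x)%R ->
  (eucl_norm (s^-1 *: y) ^+ 2 <= x)%R ->
  \int[gauss_rV n]_z (f (y + s *: z) ^+ 2)%:E < +oo ->
  \int[gauss_rV n]_z (f (s *: (c *: z)) ^+ 2)%:E = q%:E ->
  K = (Num.sqrt 2 ^+ n * expR (1 * x))%R ->
  C = (Num.sqrt 2 ^+ n * expR (3 / 2 * x))%R ->
  \int[gauss_rV n]_z (kl (f (y + s *: z) ^+ 2) q)%:E <=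
  ((3 + 9 * K + 8 * C * K) * (2 * s ^+ 2))%:E *
    \int[gauss_rV n]_z (eucl_norm (gradient f (y + s *: z)) ^+ 2)%:E.
Proof.
move=> s0 cdf f0 vx goo fq KE CE.
have mf := continuously_differentiable_measurable cdf.
pose u z := (f (y + s *: z) ^+ 2)%R.
have u0 z : (0 < u z)%R by rewrite exprn_gt0.
have mu : measurable_fun setT u.
  by apply: measurable_funX; exact: measurableT_comp mf (measurable_shift _ _).
have mEu : measurable_fun setT (fun z => (u z)%:E) by exact/measurable_EFinP.
pose a := fine (\int[gauss_rV n]_z (u z)%:E).
have ug : 0 < \int[gauss_rV n]_z (u z)%:E by exact: integral_probability_gt0.
have ua : \int[gauss_rV n]_z (u z)%:E = a%:E by rewrite fineK// ge0_fin_numE// ltW.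
have a0 : (0 < a)%R by rewrite -lte_fin -ua.
have q0 : (0 < q)%R.
  rewrite -lte_fin -fq; apply: integral_probability_gt0.
    apply/measurable_EFinP; apply: measurable_funX.
    have := measurable_affine_rV (s * c) (0 : 'rV[R]_n).
    under eq_fun do rewrite subr0 -scalerA.
    exact: measurableT_comp mf.
  by move=> z; rewrite lte_fin exprn_gt0.
have r2n : (0 <= Num.sqrt 2 ^+ n :> R)%R by rewrite exprn_ge0// sqrtr_ge0.
pose v := (s^-1 *: y)%R.
have uq : \int[gauss_rV n]_z (u z * tilt c v z)%:E = q%:E.
  rewrite -fq (integral_shift_tilt (h := fun x => (f x ^+ 2)%:E) y s0)//.
  - by apply/measurable_EFinP; exact: measurable_funX.
  - by move=> w; rewrite lee_fin sqr_ge0.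
have C0 : (0 <= C)%R by rewrite CE mulr_ge0 ?expR_ge0.
have K0 : (0 <= K)%R by rewrite KE mulr_ge0 ?expR_ge0.
rewrite EFinM -muleA.
apply: le_trans (lee_wpmul2l _ (log_sobolev_shift cdf f0 ua)); last first.
  by rewrite lee_fin addr_ge0 ?mulr_ge0// addr_ge0 ?mulr_ge0.
apply: (@kl_recentering _ _ _ (gauss_rV n) u (tilt c v) (tilt_invsqrt v)) => //.
- exact: measurable_tilt.
- exact: measurable_tilt_invsqrt.
- by move=> z; exact: tilt_gt0.
- by move=> z; exact: tilt_invsqrt_gt0.
- by move=> z; exact: tilt_invsqrtK.
- move=> z; apply: le_trans (tilt_le _ _) _.
  by rewrite KE ler_wpM2l// ler_expR !mul1r.
- exact: integral_tilt1_cst.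
- apply: le_trans (integral_tilt_invsqrt _) _.
  by rewrite CE lee_fin ler_wpM2l// ler_expR ler_wpM2l.
Qed.

End gaussian_shift.

(** * The law of [Y + s Z] as a mixture of shifted Gaussians *)

Section law_of_sum.
Context {R : realType} (n : nat) d (T : measurableType d) (P : probability T R).
Variables (Y Z : {RV P >-> 'rV[R]_n}).
Hypotheses (Z_normal : std_normal_RV Z) (YZ_indep : independent_RV Y Z).
Local Open Scope ereal_scope.

Lemma distribution_std_normal A : measurable A -> distribution P Z A = gauss_rV n A.
Proof.
move=> mA; rewrite Z_normal// integral_mkcond.
transitivity (\int[lebesgue_rV n]_x ((\1_A x)%:E * (std_normal_pdf x)%:E)).
  apply: eq_integral => x _; rewrite patchE indicE.
  by case: ifPn => _; rewrite ?mul1e ?mul0e.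
rewrite integral_std_normal_pdf//.
  by rewrite integral_indic// setIT.
exact/measurable_EFinP/measurable_indic.
Qed.

Let mYZ : measurable_fun setT (fun w => (Y w, Z w)).
Proof. exact: measurable_fun_pair. Qed.

Let YZ : {mfun T >-> ('rV[R]_n * 'rV[R]_n)%type} :=
  HB.pack (fun w => (Y w, Z w)) (isMeasurableFun.Build _ _ _ _ _ mYZ).

Let distribution_YZ X : measurable X ->
  (distribution P Y \x gauss_rV n) X = distribution P YZ X.
Proof.
apply: product_measure_unique => A B mA mB.
rewrite -[RHS]/(distribution P Y A * gauss_rV n B) -distribution_std_normal//.
exact: YZ_indep.
Qed.

Lemma integral_add_scale (s : R) (h : 'rV[R]_n -> \bar R) :
  measurable_fun setT h -> (forall x, 0 <= h x) ->
  \int[distribution P (add_scale Y Z s)]_x h x =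
  \int[distribution P Y]_y \int[gauss_rV n]_z h (y + s *: z)%R.
Proof.
move=> mh h0; rewrite ge0_integral_distribution//.
pose k (p : 'rV[R]_n * 'rV[R]_n) := h (p.1 + s *: p.2)%R.
have mk : measurable_fun setT k.
  exact: measurableT_comp mh (measurable_shift2 s).
transitivity (\int[distribution P YZ]_p k p).
  rewrite ge0_integral_distribution//; last by move=> p; exact: h0.
rewrite -(fubini_tonelli1 k)//; last by move=> p; exact: h0.
by apply: eq_measure_integral => X mX _; apply/esym; exact: distribution_YZ.
Qed.

Lemma ae_eucl_norm_sqr_le : Linfty_norm Y < +oo ->
  {ae distribution P Y, forall y,
    (eucl_norm y ^+ 2 <= fine (Linfty_norm Y) ^+ 2)%R}.
Proof.
move=> Yoo; pose M := fine (Linfty_norm Y).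
have PT : 0 < P setT by rewrite probability_setT lte01.
have YM : {ae P, forall w, (eucl_norm (Y w) <= M)%R}.
  have LE : Linfty_norm Y = ess_sup P (abse \o (fun w => (eucl_norm (Y w))%:E)).
    by rewrite /Linfty_norm unlock PT.
  have L0 : 0 <= Linfty_norm Y.
    rewrite LE; apply: (ess_sup_gee PT); apply: nearW => w /=.
    by rewrite lee_fin normr_ge0.
  have LM : Linfty_norm Y = M%:E by rewrite fineK// ge0_fin_numE.
  have := ess_sup_ge P (abse \o (fun w => (eucl_norm (Y w))%:E)).
  rewrite -LE LM; apply: filterS => w /=.
  by rewrite lee_fin ger0_norm// sqrtr_ge0.
have M0 : (0 <= M)%R.
  have [w wM] := @filter_ex _ _ (ae_properfilter_algebraOfSetsType (mu := P) PT) _ YM.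
  exact: le_trans (sqrtr_ge0 _) wM.
(* The exceptional set in [Omega] need not be a preimage under [Y]; a measurable set of vectors is
   therefore fixed first, and its preimage is contained in the exceptional set. *)
pose N := [set y : 'rV[R]_n | (M ^+ 2 < eucl_norm y ^+ 2)%R].
have mN : measurable N.
  have := @measurable_eucl_norm_sqr R n measurableT _ (measurable_itv `](M ^+ 2)%R, +oo[).
  rewrite setTI; congr measurable; apply/seteqP; split => y /=; rewrite in_itv/= andbT//.
exists N; split => //.
  have [B [mB B0 sB]] := YM.
  apply/eqP; rewrite -measure_le0 -B0 -[leLHS]/(P (Y @^-1` N)).
  apply: le_measure; rewrite ?inE//.
    by rewrite -[Y @^-1` N]setTI; apply: (measurable_funPT Y).
  move=> w Nw; apply: sB => /= wM; move: Nw; rewrite /N /= ltNge => /negP; apply.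
  by rewrite ler_pXn2r ?nnegrE ?sqrtr_ge0.
by move=> y /= /negP; rewrite -ltNge.
Qed.

End law_of_sum.

(** Since [C] and [K] are at least 1, the bracket is at most [20 * (C * K)], and
    [2 * t <= 2 * M ^ 2] yields the factor 40, well below 289. Moreover
    [C * K = 2 ^ d * exp (5 / 2 * x)], and [2 <= exp 1] moves the dimension into the exponent. *)
Lemma constant_le (R : realType) (d : nat) (M t x K C : R) : 0 < t -> t <= M ^+ 2 ->
  x = M ^+ 2 / t -> K = Num.sqrt 2 ^+ d * expR (1 * x) ->
  C = Num.sqrt 2 ^+ d * expR (3 / 2 * x) ->
  (3 + 9 * K + 8 * C * K) * (2 * t) <=
  289 * M ^+ 2 * expR (20 * d%:R + 5 * M ^+ 2 / t).
Proof.
move=> t0 tM xE KE CE.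
have x0 : 0 <= x by rewrite xE divr_ge0 ?sqr_ge0// ltW.
have r1 : 1 <= Num.sqrt 2 :> R by rewrite -[leLHS]sqrtr1 ler_wsqrtr// ler1n.
have rd1 : 1 <= Num.sqrt 2 ^+ d :> R by rewrite exprn_ege1.
have K1 : 1 <= K by rewrite KE mulr_ege1// mul1r -expR0 ler_expR.
have C1 : 1 <= C by rewrite CE mulr_ege1// -expR0 ler_expR mulr_ge0.
have CK : C * K <= expR (20 * d%:R + 5 * M ^+ 2 / t).
  have -> : C * K = 2 ^+ d * expR (5 / 2 * x).
    rewrite CE KE mulrACA -expRD -exprMn -expr2 sqr_sqrtr//; congr (_ * expR _); lra.
  have e2 : 2 <= expR 1 :> R by apply: le_trans (expR_ge1Dx 1); lra.
  have -> : 20 * d%:R + 5 * M ^+ 2 / t = d%:R * 1 + (19 * d%:R + 5 * x).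
    by rewrite xE; ring.
  have p1 : 2 ^+ d <= expR (1 : R) ^+ d.
    apply: lerXn2r; rewrite ?nnegrE// expR_ge0.
  have p2 : expR (5 / 2 * x) <= expR (19 * d%:R + 5 * x).
    by rewrite ler_expR; have : 0 <= d%:R :> R by []; lra.
  by rewrite expRD expRM_natl ler_pM ?exprn_ge0 ?expR_ge0.
have le1 : 3 + 9 * K + 8 * C * K <= 20 * (C * K) by nra.
have := ler_pM _ _ le1 (ler_wpM2l (ler0n R 2) tM).
have := ler_wpM2l (sqr_ge0 M) CK.
have := mulr_ge0 (sqr_ge0 M) (expR_ge0 (20 * d%:R + 5 * M ^+ 2 / t)).
move=> h1 h2 h3; apply: le_trans (h3 _ _) _; [nra|lra|lra].
Qed.

Section log_sobolev_of_law.
Context {R : realType} (n : nat) d (T : measurableType d) (P : probability T R).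
Variables (Y Z : {RV P >-> 'rV[R]_n}) (t : R).
Hypotheses (Y_bounded : (Linfty_norm Y < +oo)%E).
Hypotheses (Z_normal : std_normal_RV Z) (YZ_indep : independent_RV Y Z).
Hypothesis t_gt0 : 0 < t.

Let M := fine (Linfty_norm Y).
Let s := Num.sqrt t.
Let x := M ^+ 2 / t.
Let K := Num.sqrt 2 ^+ n * expR (1 * x).
Let C := Num.sqrt 2 ^+ n * expR (3 / 2 * x).
Let mu : probability 'rV[R]_n R := distribution P (add_scale Y Z s).
Let nu : probability 'rV[R]_n R := distribution P Y.

Lemma log_sobolev_law : log_sobolev mu ((3 + 9 * K + 8 * C * K) * (2 * t)).
Proof.
move=> f f0 cdf f1 foo.
have s0 : 0 < s by rewrite sqrtr_gt0.
have s2 : s ^+ 2 = t by rewrite sqr_sqrtr// ltW.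
have K0 : 0 <= K by rewrite mulr_ge0 ?expR_ge0// exprn_ge0// sqrtr_ge0.
have C0 : 0 <= C by rewrite mulr_ge0 ?expR_ge0// exprn_ge0// sqrtr_ge0.
have mf := continuously_differentiable_measurable cdf.
have mf2 : measurable_fun setT (fun x => f x ^+ 2) by exact: measurable_funX.
have mEf2 : measurable_fun setT (fun x => (f x ^+ 2)%:E) by exact/measurable_EFinP.
have f2_gt0 v : 0 < f v ^+ 2 by rewrite exprn_gt0.
have Ef2_ge0 v : (0 <= (f v ^+ 2)%:E)%E by rewrite lee_fin ltW.
pose g (y : 'rV[R]_n) := (\int[gauss_rV n]_z (f (y + s *: z) ^+ 2)%:E)%E.
pose D (y : 'rV[R]_n) := (\int[gauss_rV n]_z (eucl_norm (gradient f (y + s *: z)) ^+ 2)%:E)%E.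
have mgrad : measurable_fun setT (fun v => (eucl_norm (gradient f v) ^+ 2)%:E).
  apply/measurable_EFinP; apply: measurableT_comp (@measurable_eucl_norm_sqr R n) _.
  by apply: measurable_rV => i; exact: measurable_gradient.
have grad_ge0 v : (0 <= (eucl_norm (gradient f v) ^+ 2)%:E)%E by rewrite lee_fin sqr_ge0.
have muE := integral_add_scale Z_normal YZ_indep s.
have mg : measurable_fun setT g.
  exact: (measurable_integral_shift s (h := fun v => (f v ^+ 2)%:E)).
have mD : measurable_fun setT D.
  exact: (measurable_integral_shift s (h := fun v => (eucl_norm (gradient f v) ^+ 2)%:E)).
have g_gt0 y : (0 < g y)%E.
  apply: integral_probability_gt0 => [|z]; last by rewrite lte_fin.
  exact: measurableT_comp mEf2 (measurable_shift _ _).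
have g1 : (\int[nu]_y g y = 1)%E by rewrite -f1 muE.
have gfin : {ae nu, forall y, g y \is a fin_num}.
  by apply: (integral_finite_version mg g_gt0 _).1; rewrite g1 ltry.
pose good (y : 'rV[R]_n) := g y \is a fin_num /\ eucl_norm y ^+ 2 <= M ^+ 2.
have ae_good : {ae nu, forall y, good y}.
  have := ae_eucl_norm_sqr_le Y_bounded; apply: filterS2 gfin => y; exact: conj.
have norm_le y : good y -> eucl_norm (s^-1 *: y) ^+ 2 <= x.
  move=> [_ yM]; rewrite eucl_norm_sqr.
  under eq_bigr do rewrite mxE exprMn exprVn s2.
  by rewrite -mulr_sumr -eucl_norm_sqr mulrC ler_wpM2r// invr_ge0 ltW.
pose c := (Num.sqrt 2)^-1 : R.
pose Q := (\int[gauss_rV n]_z (f (s *: (c *: z)) ^+ 2)%:E)%E.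
have Q_gt0 : (0 < Q)%E.
  apply: integral_probability_gt0 => [|z]; last by rewrite lte_fin.
  have := measurable_affine_rV (s * c) (0 : 'rV[R]_n).
  under eq_fun do rewrite subr0 -scalerA.
  exact: measurableT_comp mEf2.
(* Finiteness of [Q] is read off from a single [y] with [g y] finite and norm at most [M], where the
   density of the reference Gaussian is bounded by [K]; almost every [y] is of this kind. *)
have Qoo : (Q < +oo)%E.
  have nuT : (0 < nu setT)%E by rewrite probability_setT lte01.
  have [y gy] := @filter_ex _ _ (ae_properfilter_algebraOfSetsType (mu := nu) nuT) _ ae_good.
  apply: (@le_lt_trans _ _ (K%:E * g y)%E); last first.
    by rewrite -(fineK gy.1) -EFinM ltry.
  rewrite /Q (integral_shift_tilt (h := fun v => (f v ^+ 2)%:E) y s0)//.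
  have mfs : measurable_fun setT (fun z : 'rV[R]_n => (f (y + s *: z) ^+ 2)%:E).
    exact: measurableT_comp mEf2 (measurable_shift _ _).
  rewrite -ge0_integralZl//; apply: ge0_le_integral => //.
  - by move=> z _; rewrite mule_ge0// lee_fin tilt_ge0// invr_gt0 sqrtr_gt0.
  - by apply: emeasurable_funM => //; apply/measurable_EFinP; exact: measurable_tilt.
  - exact: measurable_funeM.
  - move=> z _; rewrite muleC lee_wpmul2r// lee_fin (le_trans (tilt_le _ _))//.
    rewrite ler_wpM2l ?exprn_ge0 ?sqrtr_ge0// ler_expR !mul1r.
    exact: norm_le.
pose q := fine Q.
have QE : Q = q%:E by rewrite fineK// ge0_fin_numE// ltW.
have q0 : 0 < q by rewrite -lte_fin -QE.
have mkl : measurable_fun setT (fun v => (kl (f v ^+ 2) q)%:E).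
  exact/measurable_EFinP/measurable_kl.
have kl_ge v : (0 <= (kl (f v ^+ 2) q)%:E)%E by rewrite lee_fin kl_ge0// ltW.
set c0 := _ * (2 * t).
have c0_ge0 : 0 <= c0 by rewrite !mulr_ge0 ?addr_ge0 ?mulr_ge0// ltW.
have klq : (\int[mu]_v (kl (f v ^+ 2) q)%:E <=
    c0%:E * \int[mu]_v (eucl_norm (gradient f v) ^+ 2)%:E)%E.
  rewrite !muE//.
  rewrite -ge0_integralZl//; last by move=> y _; exact: integral_ge0.
  apply: (ge0_ae_le_integral _ _ _ _ ae_good).
  - exact: (measurable_integral_shift s (h := fun v => (kl (f v ^+ 2) q)%:E)).
  - exact: measurable_funeM.
  - by move=> y; exact: integral_ge0.
  - by move=> y; rewrite mule_ge0 ?lee_fin//; exact: integral_ge0.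
  - move=> y gy; rewrite /c0 -s2.
    apply: (kl_shift_le (x := x) s0 cdf f0 (norm_le y gy) _ QE erefl erefl).
    by have := gy.1; rewrite ge0_fin_numE// ltW.
(* A finite left side is what allows [kl_compensation] to move the reference constant from [q] to 1;
   it follows from the finite energy of [f]. *)
have klqoo : (\int[mu]_v (kl (f v ^+ 2) q)%:E < +oo)%E.
  by apply: le_lt_trans klq _; apply: lte_mul_pinfty.
have [ikl1 kl1E] := kl_compensation mf2 f2_gt0 q0 ltr01 f1 klqoo.
have i2 : mu.-integrable setT (EFin \o (fun v => f v ^+ 2)).
  by apply: ge0_integrable => [//|v|]; [exact: ltW|rewrite f1 ltry].
have i1 : mu.-integrable setT (EFin \o cst (1:R)).
  by apply: finite_measure_integrable_cst.
have c1 : (\int[mu]_v (cst (1:R) v)%:E = (1:R)%:E)%E.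
  rewrite /= integral_cst// mul1e; exact: probability_setT.
have [i3 i3E] := integral_affine2 1 (-1) i2 i1 f1 c1.
have entE v : ((f v ^+ 2 * ln (f v ^+ 2))%:E =
    (kl (f v ^+ 2) 1)%:E + (f v ^+ 2 * 1 + cst 1 v * -1)%:E)%E.
  by rewrite -EFinD /kl ln1 /=; congr EFin; ring.
rewrite /entropy; under eq_integral do rewrite entE.
(* Since [f ^ 2] has mean 1, its entropy equals the integral of [kl (f ^ 2) q] plus [ln q - q + 1],
   and this last quantity is at most 0. *)
rewrite integralD// i3E kl1E; apply: le_trans klq.
rewrite -addeA -EFinD -[leRHS]adde0 leeD2l// lee_fin.
have := ln_le_subr1 q0; rewrite divr1; lra.
Qed.

End log_sobolev_of_law.

Theorem theorem1p2 (R : realType) (d : nat) (d_gt0 : (0 < d)%N)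
    (disp : measure_display) (Omega : measurableType disp)
    (P : probability Omega R) (Y Z : {RV P >-> 'rV[R]_d})
    (Y_bounded : (Linfty_norm Y < +oo)%E)
    (Z_normal : std_normal_RV Z)
    (YZ_indep : independent_RV Y Z) :
  let M := fine (Linfty_norm Y) in
  forall t : R, 0 < t -> t <= M ^+ 2 ->
  exists2 c : R,
    log_sobolev (distribution P (add_scale Y Z (Num.sqrt t))) c &
    c <= 289 * M ^+ 2 * expR (20 * d%:R + 5 * M ^+ 2 / t).
Proof.
move=> M t t0 tM; eexists.
  exact: log_sobolev_law Y_bounded Z_normal YZ_indep t0.
exact: (constant_le t0 tM erefl erefl erefl).
Qed.
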